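(* Let $X,Y$ be smooth affine complex varieties and let $f=(f_1,\dots,f_r):X\to\mathbb A^r$, $g=(g_1,\dots,g_{r'}):Y\to\mathbb A^{r'}$ be morphisms with all $f_i\ne0$, $g_j\ne0$. Let $h=f\times g:X\times Y\to\mathbb A^{r+r'}$. Write the Bernstein-Sato polynomials as $$b_f(s)=\prod_\alpha(s+\alpha)^{n_\alpha},\quad b_g(s)=\prod_\beta(s+\beta)^{m_\beta},\quad b_h(s)=\prod_\gamma(s+\gamma)^{q_\gamma}.$$ Then $$q_\gamma=\max\{\,n_\alpha+m_\beta-1\mid n_\alpha>0,\ m_\beta>0,\ \alpha+\beta=\gamma\,\}$$ (with $q_\gamma=0$ if there are no such $\alpha,\beta$).
   Context: Varieties are separated schemes of finite type over $\mathbb C$. The condition $f_i\ne0$ means that $f_i$ is nonzero on every connected component of $X$ (similarly for $g_j$ on $Y$). The components of $h$ are the pull-backs of $f_1,\dots,f_r,g_1,\dots,g_{r'}$ to $X\times Y$. Bernstein-Sato polynomial of a tuple $f=(f_1,\dots,f_r)$ of nonzero functions on a smooth affine variety $X$. Let $\mathcal D_X$ be the sheaf of linear differential operators on $X$ and let $s_1,\dots,s_r$ be independent variables. $\mathcal D_X$ acts naturally on $\mathcal O_X[\prod_if_i^{-1},s_1,\dots,s_r]\prod_if_i^{s_i}$ (a vector field $\xi$ acts by $\xi(u\prod_if_i^{s_i})=(\xi u+u\sum_is_i\,\xi(f_i)/f_i)\prod_if_i^{s_i}$). Let $t_j$ be the bijective $\mathcal D_X$-linear operator on it given by $t_j\big(u(s_1,\dots,s_r)\prod_if_i^{s_i}\big)=u(s_1,\dots,s_j+1,\dots,s_r)\,f_j\prod_if_i^{s_i}$.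 Put $s_{i,j}=s_it_i^{-1}t_j$ and $s=\sum_is_i$. The Bernstein-Sato polynomial $b_f(s)$ is the monic polynomial in one variable of lowest degree such that $$b_f(s)\prod_if_i^{s_i}=\sum_{k=1}^rP_kt_k\prod_if_i^{s_i}$$ for some $P_k$ in the ring generated by $\mathcal D_X$ and the $s_{i,j}$ $(1\le i,j\le r)$. It exists and its roots are rational. *)

(* Defs.v *)
From HB Require Import structures.
From mathcomp Require Import all_boot all_order all_algebra.
From mathcomp Require Import boolp reals complex.
From mathcomp Require Import mpoly ring.

Set Implicit Arguments.
Unset Strict Implicit.
Unset Printing Implicit Defensive.

Import GRing.Theory.
Local Open Scope ring_scope.
Local Open Scope quotient_scope.

(* The localization R[F^-1].  [Frac F a n] is the fraction a / F^n; F may be a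
   zero divisor, whence the exponent k.  If F is nilpotent the localization is
   the zero ring, which is why it is only a [comPzRingType]. *)
Section Localization.
Variables (R : comPzRingType) (F : R).

Definition loc_rel (x y : R * nat) : bool :=
  `[< exists k, F ^+ k * (F ^+ y.2 * x.1) = F ^+ k * (F ^+ x.2 * y.1) >].

Lemma loc_rel_refl : reflexive loc_rel.
Proof. by move=> x; apply/asboolP; exists 0%N. Qed.

Lemma loc_rel_sym : ssrbool.symmetric loc_rel.
Proof. by move=> x y; apply/asboolP/asboolP => -[k hk]; exists k. Qed.

Lemma loc_rel_trans : transitive loc_rel.
Proof.
move=> [b n] [a m] [c p] /asboolP[/= k hk] /asboolP[/= l hl]; apply/asboolP => /=.
exists (k + l + n)%N; rewrite !exprD.
transitivity (F ^+ l * F ^+ p * (F ^+ k * (F ^+ n * a))); first by ring.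
rewrite hk.
transitivity (F ^+ k * F ^+ m * (F ^+ l * (F ^+ p * b))); first by ring.
by rewrite hl; ring.
Qed.

Canonical loc_equiv := EquivRel loc_rel loc_rel_refl loc_rel_sym loc_rel_trans.

Definition loc : Type := {eq_quot loc_equiv}.
HB.instance Definition _ := Choice.on loc.
HB.instance Definition _ := EqQuotient.on loc.

Definition Frac (a : R) (n : nat) : loc := \pi_loc (a, n).

Lemma FracE (a b : R) (m n : nat) :
  Frac a m = Frac b n <->
  exists k, F ^+ k * (F ^+ n * a) = F ^+ k * (F ^+ m * b).
Proof. by split=> [/eqmodP/asboolP | h]; last exact/eqmodP/asboolP. Qed.

Lemma FracP (P : loc -> Prop) : (forall a n, P (Frac a n)) -> forall u, P u.
Proof. by move=> h u; rewrite -[u]reprK [repr u]surjective_pairing; apply: h. Qed.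

Definition loc_lift (T : Type) (g : R -> nat -> T) (u : loc) : T :=
  g (repr u).1 (repr u).2.

Lemma loc_liftE (T : Type) (g : R -> nat -> T) (a : R) (n : nat) :
  (forall b m k, F ^+ k * (F ^+ m * a) = F ^+ k * (F ^+ n * b) -> g a n = g b m) ->
  loc_lift g (Frac a n) = g a n.
Proof.
move=> gP; rewrite /loc_lift; set x := repr _.
have : Frac a n = Frac x.1 x.2 by rewrite /Frac -surjective_pairing reprK.
by case/FracE => k /gP ->.
Qed.

Definition loc_add (u v : loc) : loc :=
  loc_lift (fun a m => loc_lift (fun b n =>
    Frac (F ^+ n * a + F ^+ m * b) (m + n)) v) u.
Definition loc_opp (u : loc) : loc := loc_lift (fun a m => Frac (- a) m) u.
Definition loc_mul (u v : loc) : loc :=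
  loc_lift (fun a m => loc_lift (fun b n => Frac (a * b) (m + n)) v) u.

Lemma loc_addE a m b n :
  loc_add (Frac a m) (Frac b n) = Frac (F ^+ n * a + F ^+ m * b) (m + n).
Proof.
have E c l : loc_lift (fun b n => Frac (F ^+ n * c + F ^+ l * b) (l + n)) (Frac b n)
           = Frac (F ^+ n * c + F ^+ l * b) (l + n).
  apply: loc_liftE => b' n' k e; apply/FracE; exists k; rewrite !exprD.
  transitivity (F ^+ k * F ^+ l * F ^+ n' * F ^+ n * c
                + F ^+ l * F ^+ l * (F ^+ k * (F ^+ n' * b))); first by ring.
  by rewrite e; ring.
rewrite /loc_add loc_liftE ?E // => a' m' k e; rewrite E.
apply/FracE; exists k; rewrite !exprD.
transitivity (F ^+ n * F ^+ n * (F ^+ k * (F ^+ m' * a))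
              + F ^+ k * F ^+ m' * F ^+ n * F ^+ m * b); first by ring.
by rewrite e; ring.
Qed.

Lemma loc_oppE a m : loc_opp (Frac a m) = Frac (- a) m.
Proof.
apply: loc_liftE => a' m' k e; apply/FracE; exists k.
transitivity (- (F ^+ k * (F ^+ m' * a))); first by ring.
by rewrite e; ring.
Qed.

Lemma loc_mulE a m b n : loc_mul (Frac a m) (Frac b n) = Frac (a * b) (m + n).
Proof.
have E c l : loc_lift (fun b n => Frac (c * b) (l + n)) (Frac b n)
           = Frac (c * b) (l + n).
  apply: loc_liftE => b' n' k e; apply/FracE; exists k; rewrite !exprD.
  transitivity (F ^+ l * c * (F ^+ k * (F ^+ n' * b))); first by ring.
  by rewrite e; ring.
rewrite /loc_mul loc_liftE ?E // => a' m' k e; rewrite E.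
apply/FracE; exists k; rewrite !exprD.
transitivity (F ^+ n * b * (F ^+ k * (F ^+ m' * a))); first by ring.
by rewrite e; ring.
Qed.

Let eqF a b m n : F ^+ n * a = F ^+ m * b -> Frac a m = Frac b n.
Proof. by move=> e; apply/FracE; exists 0%N; rewrite e. Qed.

Let addA : associative loc_add.
Proof.
apply: FracP => a m; apply: FracP => b n; apply: FracP => c p.
by rewrite !loc_addE; apply: eqF; rewrite !exprD; ring.
Qed.

Let addC : commutative loc_add.
Proof.
apply: FracP => a m; apply: FracP => b n.
by rewrite !loc_addE; apply: eqF; rewrite !exprD; ring.
Qed.

Let add0 : left_id (Frac 0 0) loc_add.
Proof. by apply: FracP => a m; rewrite loc_addE; apply: eqF; rewrite !exprD; ring. Qed.

Let addN : left_inverse (Frac 0 0) loc_opp loc_add.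
Proof.
by apply: FracP => a m; rewrite loc_oppE loc_addE; apply: eqF; rewrite !exprD; ring.
Qed.

HB.instance Definition _ := GRing.isZmodule.Build loc addA addC add0 addN.

Let mulA : associative loc_mul.
Proof.
apply: FracP => a m; apply: FracP => b n; apply: FracP => c p.
by rewrite !loc_mulE; apply: eqF; rewrite !exprD; ring.
Qed.

Let mulC : commutative loc_mul.
Proof.
apply: FracP => a m; apply: FracP => b n.
by rewrite !loc_mulE; apply: eqF; rewrite !exprD; ring.
Qed.

Let mul1 : left_id (Frac 1 0) loc_mul.
Proof. by apply: FracP => a m; rewrite loc_mulE; apply: eqF; rewrite !exprD; ring. Qed.

Let mulDl : left_distributive loc_mul loc_add.
Proof.
apply: FracP => a m; apply: FracP => b n; apply: FracP => c p.
by rewrite !(loc_mulE, loc_addE); apply: eqF; rewrite !exprD; ring.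
Qed.

HB.instance Definition _ := GRing.Zmodule_isComPzRing.Build loc mulA mulC mul1 mulDl.

Lemma FracD a b m n : Frac a m + Frac b n = Frac (F ^+ n * a + F ^+ m * b) (m + n).
Proof. exact: loc_addE. Qed.

Lemma FracM a b m n : Frac a m * Frac b n = Frac (a * b) (m + n).
Proof. exact: loc_mulE. Qed.

End Localization.

(* An affine variety X = Spec A is represented by its coordinate ring A; as A is
   a [comAlgType], X is nonempty. *)
Section AffineVarieties.
Variable C : fieldType.
Implicit Types A B T : comAlgType C.

Definition finite_type A : Prop :=
  exists (n : nat) (x : 'I_n -> A),
    forall a, exists p : {mpoly C[n]}, a = mmap (fun c => c%:A) x p.

(* Infinitesimal lifting across square-zero thickenings of affine schemes. *)
Definition formally_smooth A : Prop :=
  forall (Z Z' : comAlgType C) (q : {lrmorphism Z -> Z'}),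
    (forall z', exists z, q z = z') ->
    (forall x y, q x = 0 -> q y = 0 -> x * y = 0) ->
    forall u : {lrmorphism A -> Z'},
    exists v : {lrmorphism A -> Z}, forall a, q (v a) = u a.

Definition smooth_variety A : Prop := finite_type A /\ formally_smooth A.

(* Connected components of Spec A correspond to primitive idempotents e of A,
   and e * a is the restriction of the function a to the component of e. *)
Definition primitive_idempotent A (e : A) : Prop :=
  [/\ e * e = e, e != 0 &
      forall d : A, d * d = d -> d * e = d -> d = 0 \/ d = e].

Definition nonzero_on_components A (a : A) : Prop :=
  forall e : A, primitive_idempotent e -> e * a != 0.

Definition bilinear_map A B (V : lmodType C) (m : A -> B -> V) : Prop :=
  (forall c a a' b, m (c *: a + a') b = c *: m a b + m a' b) /\
  (forall c a b b', m a (c *: b + b') = c *: m a b + m a b').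

(* T, with i1 and i2, is the tensor product of A and B over C, i.e. the
   coordinate ring of the product, i1 and i2 being the pull-backs of functions
   along the two projections. *)
Definition product_ring A B T
    (i1 : {lrmorphism A -> T}) (i2 : {lrmorphism B -> T}) : Prop :=
  forall (V : lmodType C) (m : A -> B -> V), bilinear_map m ->
    exists2 phi : {linear T -> V}, (forall a b, phi (i1 a * i2 b) = m a b) &
      forall psi : {linear T -> V},
        (forall a b, psi (i1 a * i2 b) = m a b) -> psi =1 phi.

Definition product_map A B T (i1 : {lrmorphism A -> T}) (i2 : {lrmorphism B -> T})
    (r r' : nat) (f : 'I_r -> A) (g : 'I_r' -> B) : 'I_(r + r') -> T :=
  fun k => match split k with inl i => i1 (f i) | inr j => i2 (g j) end.

End AffineVarieties.

Section BernsteinSato.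
Variables (C : fieldType) (A : comAlgType C) (r : nat) (f : 'I_r -> A).

Definition prodf : {mpoly A[r]} := (\prod_i f i)%:MP.

(* A[prod_i f_i^-1, s_1, ..., s_r].  An element u of [Nf] stands for the
   element u * prod_i f_i^(s_i) of the free module of rank one that it spans;
   thus 1 : Nf is prod_i f_i^(s_i). *)
Definition Nf : comPzRingType := loc prodf.

Definition inN (p : {mpoly A[r]}) : Nf := Frac prodf p 0.

Definition finv (i : 'I_r) : Nf := Frac prodf (\prod_(j | j != i) f j)%:MP 1.

Lemma finvE i : inN (f i)%:MP * finv i = 1.
Proof.
rewrite FracM; apply/FracE; exists 0%N.
by rewrite expr0 !mul1r expr1 mulr1 -mpolyCM /prodf [in RHS](bigD1 i).
Qed.

Definition is_derivation (xi : {linear A -> A}) : Prop :=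
  forall a b, xi (a * b) = xi a * b + a * xi b.

(* The extension of xi to [Nf] that kills the s_i (quotient rule). *)
Definition der_ext (xi : A -> A) : Nf -> Nf :=
  loc_lift (fun p n =>
    Frac prodf (prodf * map_mpoly xi p - (map_mpoly xi prodf * p) *+ n) n.+1).

Lemma der_extE (xi : {linear A -> A}) (p : {mpoly A[r]}) (n : nat) :
  is_derivation xi ->
  der_ext xi (Frac prodf p n) =
  Frac prodf (prodf * map_mpoly xi p - (map_mpoly xi prodf * p) *+ n) n.+1.
Proof.
move=> xiM; have dM : forall p q : {mpoly A[r]},
    map_mpoly xi (p * q) = map_mpoly xi p * q + p * map_mpoly xi q.
  move=> {}p q; apply/mpolyP=> m; rewrite mcoeffD mcoeff_map_mpoly !mcoeffM.
  rewrite raddf_sum -big_split /=; apply: eq_bigr => k _.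
  by rewrite xiM !mcoeff_map_mpoly.
have dX k : prodf * map_mpoly xi (prodf ^+ k) = (map_mpoly xi prodf * prodf ^+ k) *+ k.
  elim: k => [|k IH].
    have xi1 : xi 1 = 0.
      by apply: (addIr (xi 1)); rewrite add0r -[RHS](congr1 xi (mulr1 1)) xiM mulr1 mul1r.
    by rewrite expr0 -mpolyC1 map_mpolyC /= xi1 mpolyC0 mulr0 mulr0n.
  by rewrite exprS dM mulrDr mulrCA [prodf * (prodf * _)]mulrCA IH; ring.
apply: loc_liftE => q m k; rewrite !mulrA -!exprD => e.
apply/FracE; exists k.+1.
have := congr1 (fun x => prodf * map_mpoly xi x) e.
rewrite /= !dM !mulrDr !mulrA !dX !mulrnAl => e'.
set F := prodf in e e' *; set G := map_mpoly xi F in e' *.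
have {}e' := congr1 (fun x => F ^+ 2 * (x - (G * (F ^+ (k + m) * p)) *+ (k + m + n))) e'.
rewrite /= [in RHS]e in e'.
transitivity (F ^+ 2 *
  ((G * F ^+ (k + m) * p) *+ (k + m) + F * F ^+ (k + m) * map_mpoly xi p
   - (G * (F ^+ (k + m) * p)) *+ (k + m + n))).
  by rewrite !exprS !exprD; ring.
by rewrite e' !exprS !exprD; ring.
Qed.

Definition vfield_act (xi : A -> A) (u : Nf) : Nf :=
  der_ext xi u + u * \sum_i inN 'X_i * (inN (xi (f i))%:MP * finv i).

(* The A[prod_i f_i^-1]-algebra endomorphism of [Nf] given by
   s_j |-> s_j + c and s_i |-> s_i for i != j. *)
Definition shift (c : A) (j : 'I_r) : Nf -> Nf :=
  loc_lift (fun p n =>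
    Frac prodf (p \mPo [tuple 'X_i + (if i == j then c else 0)%:MP | i < r]) n).

Lemma shiftE c j p n :
  shift c j (Frac prodf p n) =
  Frac prodf (p \mPo [tuple 'X_i + (if i == j then c else 0)%:MP | i < r]) n.
Proof.
apply: loc_liftE => q m k e; apply/FracE; exists k.
move: (congr1 (comp_mpoly [tuple 'X_i + (if i == j then c else 0)%:MP | i < r]) e).
by rewrite !rmorphM !rmorphXn /= !comp_mpolyC.
Qed.

Lemma shiftK c j : cancel (shift c j) (shift (- c) j).
Proof.
apply: FracP => p n; rewrite !shiftE; congr Frac.
rewrite (comp_mpolyE p) linear_sum [RHS](mpolyE p) /=.
apply: eq_bigr => m _; rewrite comp_mpolyZ; congr (_ *: _).
rewrite rmorph_prod [RHS]mpolyXE_id; apply: eq_bigr => i _.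
rewrite rmorphXn; congr (_ ^+ _).
rewrite tnth_mktuple /= comp_mpolyD comp_mpolyC comp_mpolyXU -tnth_nth tnth_mktuple.
by rewrite -addrA -mpolyCD; case: eqP => _; rewrite ?subrr ?addNr ?addr0 ?mpolyC0 ?addr0.
Qed.

Definition t_op (j : 'I_r) (u : Nf) : Nf := shift 1 j u * inN (f j)%:MP.
Definition t_inv (j : 'I_r) (u : Nf) : Nf := shift (-1) j u * finv j.

Lemma shiftM c j : {morph shift c j : u v / u * v}.
Proof.
apply: FracP => p m; apply: FracP => q n.
by rewrite FracM !shiftE FracM rmorphM.
Qed.

Lemma shift_inN c j a : shift c j (inN a%:MP) = inN a%:MP.
Proof. by rewrite shiftE comp_mpolyC. Qed.

Lemma shift_finv c j i : shift c j (finv i) = finv i.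
Proof. by rewrite shiftE comp_mpolyC. Qed.

Lemma t_opK j : cancel (t_op j) (t_inv j).
Proof.
by move=> u; rewrite /t_inv /t_op shiftM shiftK shift_inN -mulrA finvE mulr1.
Qed.

Lemma t_invK j : cancel (t_inv j) (t_op j).
Proof.
move=> u; rewrite /t_inv /t_op shiftM shift_finv -[X in shift X j (shift _ j u)]opprK.
by rewrite shiftK -mulrA (mulrC (finv j)) finvE mulr1.
Qed.

Definition s_op (i j : 'I_r) (u : Nf) : Nf := inN 'X_i * t_inv i (t_op j u).

(* The ring generated by D_X and the s_{i,j}, as a ring of operators on [Nf].
   X being smooth, D_X is the ring generated by functions and vector fields, the
   latter acting on [Nf] through [vfield_act]. *)
Inductive DS_op : (Nf -> Nf) -> Prop :=
| DS_fun (a : A) : DS_op (fun u => inN a%:MP * u)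
| DS_vfield (xi : {linear A -> A}) : is_derivation xi -> DS_op (vfield_act xi)
| DS_s (i j : 'I_r) : DS_op (s_op i j)
| DS_add (P Q : Nf -> Nf) : DS_op P -> DS_op Q -> DS_op (fun u => P u + Q u)
| DS_opp (P : Nf -> Nf) : DS_op P -> DS_op (fun u => - P u)
| DS_comp (P Q : Nf -> Nf) : DS_op P -> DS_op Q -> DS_op (fun u => P (Q u)).

(* b(s) with s = s_1 + ... + s_r. *)
Definition eval_s (b : {poly C}) : {mpoly A[r]} :=
  (map_poly (fun c : C => (c%:A : A)%:MP) b).[\sum_i 'X_i].

Definition functional_equation (b : {poly C}) : Prop :=
  exists P : 'I_r -> Nf -> Nf,
    (forall k, DS_op (P k)) /\ inN (eval_s b) * 1 = \sum_k P k (t_op k 1).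

Definition is_BernsteinSato (b : {poly C}) : Prop :=
  [/\ b \is monic, functional_equation b &
      forall b' : {poly C}, b' \is monic -> functional_equation b' ->
        (size b <= size b')%N].

End BernsteinSato.

(* q is the maximum of the set E, with the convention max of the empty set = 0. *)
Definition is_max0 (E : nat -> Prop) (q : nat) : Prop :=
  (E q /\ forall k, E k -> (k <= q)%N) \/ ((forall k, ~ E k) /\ q = 0%N).

(* The exponent of the factor (s + alpha) in b; the root is - alpha. *)
Definition mult (C : fieldType) (b : {poly C}) (alpha : C) : nat := mup (- alpha) b.

(* Main.v *)
Require Import Defs.
From HB Require Import structures.
From mathcomp Require Import all_boot all_order all_algebra.
From mathcomp Require Import boolp reals complex.
From mathcomp Require classical_sets.
From mathcomp Require Import ssrcomplements mpoly ring zify.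

(** Let V^1_f be the submodule of [Nf f] generated, under the operators of
    [DS_op], by the elements t_k f^s.  A polynomial b satisfies the functional
    equation if and only if b(s) f^s lies in V^1_f, so b_f is the minimal
    polynomial of s on the class of f^s modulo V^1_f ([functional_equationE],
    [BernsteinSato_dvdp]).  The modules of f and g map to that of h, with
    s_h = s_f + s_g, and the point is that

      c(s_h) h^s lies in V^1_h  iff  c(x + y) lies in (b_f(x), b_g(y)) in C[x, y].

    Near the point (-a, -b) the ideal on the right is ((x+a)^n, (y+b)^m), where
    n and m are the multiplicities of a and b; it contains (x+a + y+b)^k exactly
    when k >= n + m - 1, because in characteristic 0 the coefficient of
    (x+a)^(n-1) (y+b)^(m-1) in the power n + m - 2 is a nonzero binomial
    coefficient.  This gives the formula of the theorem.

    From right to left, the operators of each factor extend to the product, so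
    V^1_f and V^1_g map to V^1_h ([V1_iota1], [V1_iota2]); the local statements at
    the points (-a, -b) are glued by the Nullstellensatz in one variable
    ([ideal_without_zeros]), first in x and then in y ([upper_bound]).

    From left to right, the difficulty is that V^1_f (x) N_g + N_f (x) V^1_g is
    not stable in general under the mixed operators s_{i,j} = d_i t_j, where t_j acts on one
    factor and d_i = s_i t_i^(-1), which is - d/dt_i on the graph of f, on the
    other.  One therefore extends V^1_f to a decreasing filtration V^k_f, k in Z,
    such that t_i V^k is in V^(k+1) and d_i V^k in V^(k-1).  The sum of the
    V^j_f (x) V^(1-j)_g over all j is then stable under all operators, hence
    contains V^1_h ([V1_V1prod]); and in each of its terms one of the two indices
    is at least 1.  So V^1_h is killed by phi (x) psi as soon as phi kills V^1_f
    and psi kills V^1_g ([product_functional_V1]), and functionals that detect the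
    highest nilpotent vectors at a and b show that b_h vanishes to order at least
    n + m - 1 ([lower_bound]).

    A vector field on the product need not come from the factors; that it is a
    finite sum of vector fields of the factors with function coefficients
    ([decompose_derivation]) is where the finite generation of the coordinate
    rings enters. *)

Set Implicit Arguments.
Unset Strict Implicit.
Unset Printing Implicit Defensive.

Import GRing.Theory.
Local Open Scope ring_scope.
(* [finv] is also the inverse of an injection of a finite type to itself. *)
Local Notation finv := Defs.finv.

(** * Linear functionals *)

Section Functionals.
Variables (C : fieldType) (V : lmodType C).

Definition subspace (W : V -> Prop) : Prop :=
  W 0 /\ forall c x y, W x -> W y -> W (c *: x + y).

(** A maximal subspace avoiding u, from Zorn's lemma, is a hyperplane supplement
    of u: adding to it any v outside must bring u in. *)
Lemma subspace_avoiding_max (W : V -> Prop) (u : V) :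
  subspace W -> ~ W u ->
  exists M : V -> Prop, [/\ subspace M, ~ M u, (forall x, W x -> M x) &
    forall v, ~ M v -> exists c, M (u - c *: v)].
Proof.
move=> sW Wu.
pose S := {M : V -> Prop | [/\ subspace M, ~ M u & forall x, W x -> M x]}.
pose le (M M' : S) : bool := `[< forall x, sval M x -> sval M' x >].
pose W0 : S := exist _ W (And3 sW Wu (fun x h => h)).
have [|||M maxM] := @classical_sets.ZL_preorder S W0 le.
- by move=> M; apply/asboolP.
- by move=> M2 M1 M3 /asboolP h1 /asboolP h2; apply/asboolP => x /h1 /h2.
- move=> D totD.
  have [[M0 DM0]|D0] := pselect (exists M, D M); last first.
    by exists W0 => M DM; case: D0; exists M.
  pose U x := exists2 M, D M & sval M x.
  have sub : [/\ subspace U, ~ U u & forall x, W x -> U x].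
    split.
    - split; first by exists M0 => //; case: (svalP M0) => -[].
      move=> c x y [M DM Mx] [M' DM' M'y].
      have [/asboolP le12|/asboolP le21] := totD _ _ DM DM'.
        exists M' => //; case: (svalP M') => -[_ h] _ _.
        by apply: h => //; apply: le12.
      exists M => //; case: (svalP M) => -[_ h] _ _.
      by apply: h => //; apply: le21.
    - by case=> M _; case: (svalP M).
    - by move=> x Wx; exists M0 => //; case: (svalP M0) => _ _; apply.
  by exists (exist _ U sub : S) => M DM; apply/asboolP => x Mx; exists M.
case: (svalP M) => -[M_0 M_lin] Mu WM; exists (sval M); split=> // v Mv.
apply: contrapT => h.
pose U x := exists c, sval M (x - c *: v).
have sub : [/\ subspace U, ~ U u & forall x, W x -> U x].
  split=> //.
  - split; first by exists 0; rewrite scale0r subr0.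
    move=> a x y [c Mx] [d My]; exists (a * c + d).
    have -> : a *: x + y - (a * c + d) *: v = a *: (x - c *: v) + (y - d *: v).
      by rewrite scalerBr scalerA scalerDl opprD addrACA.
    exact: M_lin.
  - by move=> x Wx; exists 0; rewrite scale0r subr0; apply: WM.
apply: Mv.
have /asboolP : le (exist _ U sub : S) M.
  by apply: maxM; apply/asboolP => x Mx; exists 0; rewrite scale0r subr0.
by apply; exists 1; rewrite scale1r subrr.
Qed.

(** The coordinate along u in the decomposition of V as M + C u, where M is a
    maximal subspace containing W and avoiding u. *)
Lemma separating_functional (W : V -> Prop) (u : V) :
  subspace W -> ~ W u ->
  exists phi : {linear V -> C^o}, (forall w, W w -> phi w = 0) /\ phi u = 1.
Proof.
move=> sW Wu; have [M [[M0 M_lin] Mu WM maxM]] := subspace_avoiding_max sW Wu.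
have MZ c x : M x -> M (c *: x) by move=> Mx; rewrite -[_ *: _]addr0; apply: M_lin.
have MD x y : M x -> M y -> M (x + y).
  by move=> Mx My; rewrite -[x]scale1r; apply: M_lin.
have dec v : exists c, M (v - c *: u).
  have [Mv|/maxM [c Mc]] := pselect (M v).
    by exists 0; rewrite scale0r subr0.
  have c0 : c != 0.
    by apply: contra_notN Mu => /eqP c0; rewrite c0 scale0r subr0 in Mc.
  exists c^-1; have := MZ (- c^-1) _ Mc.
  by rewrite scalerBr scaleNr scaleNr opprK scalerA mulVf // scale1r addrC.
have uniq v c d : M (v - c *: u) -> M (v - d *: u) -> c = d.
  move=> Mc Md; apply/eqP; rewrite -subr_eq0; apply: contra_notT Mu => cd.
  have := MZ (c - d)^-1 _ (M_lin (-1) _ _ Mc Md).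
  rewrite scaleN1r opprB addrA subrK -scalerBl scalerA mulVf // scale1r //.
pose phi v : C^o := projT1 (cid (dec v)).
have phiP v : M (v - phi v *: u) by rewrite /phi; case: cid.
have phi_lin : linear phi.
  move=> c x y; apply: (uniq (c *: x + y)) => //.
  have -> : c *: x + y - (c *: phi x + phi y) *: u
          = c *: (x - phi x *: u) + (y - phi y *: u).
    by rewrite scalerBr scalerA scalerDl opprD addrACA.
  by apply: M_lin.
pose phiL := GRing.isLinear.Build C V C^o *:%R phi phi_lin.
pose Phi : {linear V -> C^o} := HB.pack phi phiL.
exists Phi; split=> [w Ww|].
  by apply: (uniq w) => //; rewrite scale0r subr0; apply: WM.
by apply: (uniq u) => //; rewrite scale1r subrr.
Qed.

End Functionals.

(** * Tensor products of algebras *)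

Section FiniteRank.
Variables (C : fieldType) (V : lmodType C).

(** A substitute for a basis of the span of L, together with coordinate functionals
    on the whole of V.  One adds the elements of L one at a time: if p is the
    operator built so far, the new term is e = v - p v, with a coefficient that
    factors through 1 - p and hence vanishes where p is already the identity. *)
Lemma finite_rank_identity (L : seq V) :
  exists (K : nat) (beta : 'I_K -> {linear V -> C^o}) (b : 'I_K -> V),
    forall v, v \in L -> \sum_k (beta k v : C) *: b k = v.
Proof.
elim: L => [|v L [K [beta [b betaP]]]].
  by exists 0%N, (fun=> \0), (fun=> 0).
pose p w := \sum_k (beta k w : C) *: b k.
have p_lin : linear p.
  move=> c x y; rewrite /p scaler_sumr -big_split; apply: eq_bigr => k _ /=.
  by rewrite linearP scalerDl scalerA.
pose e := v - p v.
have [e0|e0] := eqVneq e 0.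
  exists K, beta, b => w; rewrite inE => /orP[/eqP->|/betaP//].
  by apply/esym/eqP; rewrite -subr_eq0; apply/eqP.
have triv : subspace (fun w : V => w = 0).
  by split=> // c x y -> ->; rewrite scaler0 addr0.
have [phi [_ phie]] := separating_functional triv (elimN eqP e0).
pose gamma w : C^o := phi (w - p w).
have gamma_lin : linear gamma.
  move=> c x y; rewrite /gamma p_lin -linearP; congr (phi _).
  by rewrite scalerBr opprD addrACA.
pose Gamma : {linear V -> C^o} :=
  HB.pack gamma (GRing.isLinear.Build C V C^o *:%R gamma gamma_lin).
exists K.+1, (fun k => if unlift ord0 k is Some j then beta j else Gamma).
exists (fun k => if unlift ord0 k is Some j then b j else e) => w.
rewrite big_ord_recl unlift_none /=.
under eq_bigr do rewrite liftK.
rewrite -/(p w) inE => /orP[/eqP->|/betaP pw].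
  by rewrite /gamma -/e phie scale1r subrK.
by rewrite /gamma (_ : p w = w) // subrr linear0 scale0r add0r.
Qed.

End FiniteRank.

Section FiniteType.
Variables (C : fieldType) (A : comAlgType C).

Lemma subalgebra_ind (n : nat) (x : 'I_n -> A) (P : A -> Prop) :
  (forall a, exists p : {mpoly C[n]}, a = mmap (fun c => c%:A) x p) ->
  (forall c : C, P c%:A) -> (forall i, P (x i)) ->
  (forall a b, P a -> P b -> P (a + b)) ->
  (forall a b, P a -> P b -> P (a * b)) -> forall a, P a.
Proof.
move=> gen Pc Px PD PM a; have [p ->] := gen a.
have P0 : P 0 by rewrite -(scale0r 1).
have P1 : P 1 by rewrite -(scale1r 1).
apply: (big_ind P P0 PD) => m _; apply: (PM) => //.
apply: (big_ind P P1 PM) => i _.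
elim: (m i : nat) => [|k IH]; first by rewrite expr0.
by rewrite exprS; apply: PM.
Qed.

Lemma derivation1 (xi : {linear A -> A}) : is_derivation xi -> xi 1 = 0.
Proof.
move=> xiM; apply: (addIr (xi 1)).
by rewrite add0r -[RHS](congr1 xi (mulr1 1)) xiM mulr1 mul1r.
Qed.

End FiniteType.

Section Tensor.
Variables (C : fieldType) (A B T : comAlgType C).
Variables (i1 : {lrmorphism A -> T}) (i2 : {lrmorphism B -> T}).
Hypothesis prodT : product_ring i1 i2.

Lemma product_ring_sym : product_ring i2 i1.
Proof.
move=> V m [ml mr]; have [|phi phiE phi_uniq] := prodT (m := fun a b => m b a).
  by split.
exists phi => [a b|psi psiE]; first by rewrite mulrC.
by apply: phi_uniq => a b; rewrite mulrC.
Qed.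

(** If the span of the pure tensors were not everything, a nonzero functional
    would vanish on it, against the uniqueness in the universal property. *)
Lemma tensor_ind (P : T -> Prop) :
  P 0 -> (forall x y, P x -> P y -> P (x + y)) ->
  (forall a b, P (i1 a * i2 b)) -> forall t, P t.
Proof.
move=> P0 PD Pt t.
pose W (t : T) := exists s : seq (A * B), t = \sum_(x <- s) i1 x.1 * i2 x.2.
suff [s ->] : W t by apply: big_ind.
have sW : subspace W.
  split; first by exists [::]; rewrite big_nil.
  move=> c _ _ [s ->] [s' ->]; exists ([seq (c *: x.1, x.2) | x <- s] ++ s').
  rewrite big_cat big_map scaler_sumr /=; congr (_ + _).
  by apply: eq_bigr => x _; rewrite linearZ /= scalerAl.
apply: contrapT => /(separating_functional sW)[phi [phiW phit]].
(* Both phi and 0 extend the zero bilinear map. *)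
have [|psi _ psi_uniq] := prodT (V := C^o) (m := fun _ _ => 0).
  by split=> *; rewrite scaler0 addr0.
have phi0 := psi_uniq phi; have null0 := psi_uniq \0.
have : phi t = 0.
  rewrite phi0 -?null0 // => a b; apply: phiW.
  by exists [:: (a, b)]; rewrite big_seq1.
by move/eqP; rewrite phit oner_eq0.
Qed.

(** The map id (x) beta, which is A-linear. *)
Lemma contraction (beta : {linear B -> C^o}) :
  exists pi : {linear T -> A},
    (forall a b, pi (i1 a * i2 b) = (beta b : C) *: a) /\
    forall a t, pi (i1 a * t) = a * pi t.
Proof.
have [|pi piE _] := prodT (m := fun a b => (beta b : C) *: a).
  split=> [c a a' b|c a b b']; first by rewrite scalerDr !scalerA mulrC.
  by rewrite linearP scalerDl scalerA.
exists pi; split=> // a; apply: tensor_ind => [|x y hx hy|a' b].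
- by rewrite mulr0 linear0 mulr0.
- by rewrite mulrDr !linearD hx hy mulrDr.
- by rewrite mulrA -rmorphM !piE scalerAr.
Qed.

(** The vector field xi (x) 1 on the product. *)
Lemma extend_derivation (xi : {linear A -> A}) : is_derivation xi ->
  exists Xi : {linear T -> T}, is_derivation Xi /\
    forall a b, Xi (i1 a * i2 b) = i1 (xi a) * i2 b.
Proof.
move=> xiM; have [|Xi XiE _] := prodT (m := fun a b => i1 (xi a) * i2 b).
  split=> [c a a' b|c a b b'].
    by rewrite !linearP /= mulrDl scalerAl.
  by rewrite linearP mulrDr scalerAr.
exists Xi; split=> // x y; move: x.
apply: tensor_ind => [|x x' hx hx'|a b].
- by rewrite mul0r linear0 !mul0r addr0.
- by rewrite mulrDl !linearD hx hx' !mulrDl addrACA.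
move: y; apply: tensor_ind => [|y y' hy hy'|a' b'].
- by rewrite mulr0 linear0 !mulr0 addr0.
- by rewrite mulrDr !linearD hy hy' !mulrDr addrACA.
rewrite mulrACA -!rmorphM !XiE xiM rmorphD !rmorphM; ring.
Qed.

(** A tensor involves finitely many elements of B, so an operator on B that fixes
    these elements fixes the tensor. *)
Lemma tensor_support (t : T) : exists L : seq B,
  forall (K : nat) (beta : 'I_K -> {linear B -> C^o}) (b : 'I_K -> B)
    (pi : 'I_K -> {linear T -> A}),
    (forall y, y \in L -> \sum_k (beta k y : C) *: b k = y) ->
    (forall k x y, pi k (i1 x * i2 y) = (beta k y : C) *: x) ->
    \sum_k i1 (pi k t) * i2 (b k) = t.
Proof.
move: t; apply: tensor_ind => [|x x' [L hx] [L' hx']|a y].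
- exists [::] => K beta b pi _ _; apply: big1 => k _.
  by rewrite !linear0 mul0r.
- exists (L ++ L') => K beta b pi hL hpi.
  rewrite -[in RHS](hx K beta b pi) -1?[in RHS](hx' K beta b pi) //; first last.
  + by move=> y yL; apply: hL; rewrite mem_cat yL.
  + by move=> y yL; apply: hL; rewrite mem_cat yL orbT.
  by rewrite -big_split; apply: eq_bigr => k _; rewrite !linearD mulrDl.
exists [:: y] => K beta b pi hL hpi.
rewrite -[in RHS](hL y (mem_head _ _)) linear_sum mulr_sumr.
apply: eq_bigr => k _.
by rewrite hpi !linearZ /= -scalerAl -scalerAr.
Qed.

(** The values of Xi on finitely many generators of A involve a finite list L of
    elements of B.  With coordinates beta_k, b_k that reproduce L, the derivations
    (id (x) beta_k) o Xi of A are the coefficients: both sides are derivations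
    from A to T that agree on the generators. *)
Lemma decompose_derivation (Xi : {linear T -> T}) :
  finite_type A -> is_derivation Xi ->
  exists (K : nat) (xi : 'I_K -> {linear A -> A}) (b : 'I_K -> B),
    (forall k, is_derivation (xi k)) /\
    forall a, Xi (i1 a) = \sum_k i1 (xi k a) * i2 (b k).
Proof.
move=> [n [x gen]] XiM.
have [L LP] : exists L : seq B, forall (l : 'I_n)
    (K : nat) (beta : 'I_K -> {linear B -> C^o}) (b : 'I_K -> B)
    (pi : 'I_K -> {linear T -> A}),
    (forall y, y \in L -> \sum_k (beta k y : C) *: b k = y) ->
    (forall k x y, pi k (i1 x * i2 y) = (beta k y : C) *: x) ->
    \sum_k i1 (pi k (Xi (i1 (x l)))) * i2 (b k) = Xi (i1 (x l)).
  have [Lf LfP] := choice (fun l => tensor_support (Xi (i1 (x l)))).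
  exists (flatten [seq Lf l | l <- enum 'I_n]) => l K beta b pi hL hpi.
  apply: (LfP l K beta b pi) => // y yL; apply: hL.
  by apply/flatten_mapP; exists l; rewrite ?mem_enum.
have [K [beta [b betaP]]] := finite_rank_identity L.
have [pi piP] := choice (fun k => contraction (beta k)).
pose xi k (a : A) : A := pi k (Xi (i1 a)).
have xi_lin k : linear (xi k) by move=> c a a'; rewrite /xi !linearP.
pose xiL k : {linear A -> A} :=
  HB.pack (xi k) (GRing.isLinear.Build C A A *:%R (xi k) (xi_lin k)).
have xiM k : is_derivation (xiL k).
  move=> a a' /=; rewrite /xi rmorphM XiM linearD addrC [Xi _ * _]mulrC.
  by rewrite !(proj2 (piP k)) addrC [a' * _]mulrC.
exists K, xiL, b; split=> //.
apply: (subalgebra_ind gen) => [c|l|a a' ha ha'|a a' ha ha'].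
- rewrite linearZ /= rmorph1 linearZ /= derivation1 // scaler0 big1 // => k _.
  by rewrite /xi linearZ /= rmorph1 linearZ /= derivation1 // scaler0 !linear0 mul0r.
- by apply/esym/(LP l K beta b pi) => // k; case: (piP k).
- by rewrite !linearD ha ha' -big_split; apply: eq_bigr => k _; rewrite !linearD mulrDl.
- rewrite rmorphM XiM ha ha' mulr_suml mulr_sumr -big_split /=.
  apply: eq_bigr => k _; have /= -> := xiM k a a'.
  by rewrite rmorphD !rmorphM /=; ring.
Qed.

End Tensor.

(** * The module generated by the formal power of f *)

Section Localization.
Variables (R S : comPzRingType) (F : R) (phi : {rmorphism R -> S}) (y : S).

Definition loc_extend (u : loc F) : S := loc_lift (fun a n => phi a * y ^+ n) u.

Hypothesis yF : phi F * y = 1.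

Lemma loc_extendE a n : loc_extend (Frac F a n) = phi a * y ^+ n.
Proof.
apply: loc_liftE => b m k /(congr1 phi); rewrite !rmorphM !rmorphXn /= => e.
have yFn l : y ^+ l * phi F ^+ l = 1 by rewrite -exprMn mulrC yF expr1n.
rewrite -[LHS]mul1r -[RHS]mul1r -(yFn (k + m + n)%N) !exprD.
transitivity (y ^+ k * y ^+ m * y ^+ n * y ^+ n
   * (phi F ^+ k * (phi F ^+ m * phi a)) * phi F ^+ n); first by ring.
rewrite e.
transitivity (y ^+ k * y ^+ m * y ^+ n * phi F ^+ k * phi F ^+ n * phi b
   * (y ^+ n * phi F ^+ n)); first by ring.
by rewrite yFn -(yFn m); ring.
Qed.

Lemma loc_extend_zmod_morphism : zmod_morphism loc_extend.
Proof.
apply: FracP => a m; apply: FracP => b n.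
have -> : - Frac F b n = Frac F (- b) n by apply: loc_oppE.
rewrite FracD !loc_extendE rmorphD !rmorphM !rmorphXn rmorphN /= exprD.
have yFn l : y ^+ l * phi F ^+ l = 1 by rewrite -exprMn mulrC yF expr1n.
transitivity (phi a * y ^+ m * (y ^+ n * phi F ^+ n)
            - phi b * y ^+ n * (y ^+ m * phi F ^+ m)); first by ring.
by rewrite !yFn !mulr1.
Qed.

Lemma loc_extend_monoid_morphism : monoid_morphism loc_extend.
Proof.
split; first by rewrite [1]/(Frac F 1 0) loc_extendE rmorph1 mul1r.
apply: FracP => a m; apply: FracP => b n.
by rewrite FracM !loc_extendE rmorphM exprD mulrACA.
Qed.

End Localization.

Section InverseUniqueness.
Variable S : comPzRingType.

Lemma inverse_unique (x y z : S) : x * y = 1 -> x * z = 1 -> y = z.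
Proof. by move=> xy xz; rewrite -[y]mulr1 -xz mulrCA mulrA xy mul1r. Qed.

End InverseUniqueness.

Section TwistedModule.
Variables (C : fieldType) (A : comAlgType C) (r : nat) (f : 'I_r -> A).
Local Notation N := (Nf f).

Lemma inN_zmod_morphism : zmod_morphism (inN f).
Proof.
move=> p q; rewrite /inN.
have -> : - Frac (prodf f) q 0 = Frac (prodf f) (- q) 0 by apply: loc_oppE.
by rewrite FracD !expr0 !mul1r.
Qed.

Lemma inN_monoid_morphism : monoid_morphism (inN f).
Proof. by split=> // p q; rewrite /inN FracM. Qed.

HB.instance Definition _ :=
  GRing.isZmodMorphism.Build {mpoly A[r]} N (inN f) inN_zmod_morphism.
HB.instance Definition _ :=
  GRing.isMonoidMorphism.Build {mpoly A[r]} N (inN f) inN_monoid_morphism.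

Definition funN (a : A) : N := inN f a%:MP.
Definition sN (i : 'I_r) : N := inN f 'X_i.

Lemma funN_zmod_morphism : zmod_morphism funN.
Proof. by move=> a b; rewrite /funN !rmorphB. Qed.

Lemma funN_monoid_morphism : monoid_morphism funN.
Proof. by split=> [|a b]; rewrite /funN ?rmorph1 ?rmorphM. Qed.

HB.instance Definition _ :=
  GRing.isZmodMorphism.Build A N funN funN_zmod_morphism.
HB.instance Definition _ :=
  GRing.isMonoidMorphism.Build A N funN funN_monoid_morphism.

Lemma funN_finv i : funN (f i) * finv f i = 1.
Proof. exact: finvE. Qed.

Lemma inN_prodf : inN f (prodf f) = \prod_i funN (f i).
Proof. by rewrite /prodf [LHS](rmorph_prod funN). Qed.

Lemma inN_prodf_inv : inN f (prodf f) * \prod_i finv f i = 1.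
Proof. by rewrite inN_prodf -big_split big1 // => i _; apply: finvE. Qed.

Lemma FracN p n : Frac (prodf f) p n = inN f p * (\prod_i finv f i) ^+ n.
Proof.
rewrite -(inverse_unique (y := Frac (prodf f) 1 1) (z := \prod_i finv f i)
            (x := inN f (prodf f))) ?inN_prodf_inv //; last first.
  by rewrite FracM; apply/FracE; exists 0%N; rewrite !expr0 expr1 !mul1r !mulr1.
elim: n p => [|n IH] p; first by rewrite expr0 mulr1.
by rewrite exprSr mulrA -IH FracM mulr1 addn1.
Qed.

Lemma inN_ind (P : N -> Prop) :
  (forall u v, P u -> P v -> P (u + v)) -> (forall u v, P u -> P v -> P (u * v)) ->
  (forall a, P (funN a)) -> (forall i, P (sN i)) -> forall p, P (inN f p).
Proof.
move=> PD PM Pa Ps p; rewrite [p]mpolyE rmorph_sum.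
have P0 : P 0 by rewrite -(rmorph0 funN).
have P1 : P 1 by rewrite -(rmorph1 funN).
apply: (big_ind P P0 PD) => m _; rewrite -mul_mpolyC rmorphM /=.
apply: (PM); first exact: Pa.
rewrite mpolyXE_id rmorph_prod; apply: (big_ind P P1 PM) => i _ /=.
rewrite rmorphXn /=; elim: (m i : nat) => [|k IH]; first by rewrite expr0.
by rewrite exprS; apply: (PM); first exact: Ps.
Qed.

(** [Nf f] is generated as a ring by functions, the s_i and the inverses of the
    f_i. *)
Lemma Nf_ind (P : N -> Prop) :
  (forall u v, P u -> P v -> P (u + v)) -> (forall u v, P u -> P v -> P (u * v)) ->
  (forall a, P (funN a)) -> (forall i, P (sN i)) -> (forall i, P (finv f i)) ->
  forall u, P u.
Proof.
move=> PD PM Pa Ps Pinv; apply: FracP => p n; rewrite FracN.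
have P1 : P 1 by rewrite -(rmorph1 funN).
apply: (PM); first exact: inN_ind.
elim: n => [|n IH]; rewrite ?expr0 // exprS; apply: (PM); last exact: IH.
exact: (big_ind P P1 PM).
Qed.

Lemma Nf_rmorph_ext (S : comPzRingType) (g h : {rmorphism N -> S}) :
  (forall a, g (funN a) = h (funN a)) -> (forall i, g (sN i) = h (sN i)) ->
  g =1 h.
Proof.
move=> ga gs; apply: Nf_ind => // [u v hu hv|u v hu hv|i].
- by rewrite !rmorphD hu hv.
- by rewrite !rmorphM hu hv.
- apply: (inverse_unique (x := g (funN (f i)))).
    by rewrite -rmorphM funN_finv rmorph1.
  by rewrite ga -rmorphM funN_finv rmorph1.
Qed.

(** A derivation along a ring morphism is determined on the inverses of the f_i
    by its values on the f_i. *)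
Lemma Nf_derivation_ext (S : comPzRingType) (g : {rmorphism N -> S})
    (D E : N -> S) :
  (forall u v, D (u + v) = D u + D v) -> (forall u v, E (u + v) = E u + E v) ->
  (forall u v, D (u * v) = D u * g v + g u * D v) ->
  (forall u v, E (u * v) = E u * g v + g u * E v) ->
  (forall a, D (funN a) = E (funN a)) -> (forall i, D (sN i) = E (sN i)) ->
  D =1 E.
Proof.
move=> DD ED DM EM Da Ds; apply: Nf_ind => // [u v hu hv|u v hu hv|i].
- by rewrite DD ED hu hv.
- by rewrite DM EM hu hv.
have inv (X : N -> S) : (forall u v, X (u * v) = X u * g v + g u * X v) ->
    X (finv f i) = - (g (finv f i)) ^+ 2 * X (funN (f i)).
  move=> XM; have gfi : g (finv f i) * g (funN (f i)) = 1.
    by rewrite -rmorphM mulrC funN_finv rmorph1.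
  have X1 : X 1 = 0.
    by apply: (addIr (X 1)); rewrite -[in RHS](mulr1 1) XM rmorph1 mulr1 mul1r add0r.
  have := congr1 ( *%R (g (finv f i))) (XM (funN (f i)) (finv f i)).
  rewrite funN_finv X1 mulr0 mulrDr !mulrA gfi mul1r => e.
  by apply/eqP; rewrite -subr_eq0; apply/eqP; rewrite [RHS]e; ring.
by rewrite (inv D DM) (inv E EM) Da.
Qed.

Lemma shift_zmod_morphism c j : zmod_morphism (shift (f := f) c j).
Proof.
have D u v : shift c j (u + v) = shift c j u + shift c j v :> N.
  move: u v; apply: FracP => p m; apply: FracP => q n.
  by rewrite FracD !shiftE FracD rmorphD !rmorphM !rmorphXn /= !comp_mpolyC.
by move=> u v; apply: (addIr (shift c j v)); rewrite -D !subrK.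
Qed.

Lemma shift_monoid_morphism c j : monoid_morphism (shift (f := f) c j).
Proof. by split; [exact: (shift_inN f c j 1)|exact: shiftM]. Qed.

HB.instance Definition _ c j :=
  GRing.isZmodMorphism.Build N N (shift c j) (shift_zmod_morphism c j).
HB.instance Definition _ c j :=
  GRing.isMonoidMorphism.Build N N (shift c j) (shift_monoid_morphism c j).

Lemma shift_funN c j a : shift c j (funN a) = funN a.
Proof. exact: shift_inN. Qed.

Lemma shift_sN c j i : shift c j (sN i) = sN i + funN (if i == j then c else 0).
Proof. by rewrite shiftE comp_mpolyXU -tnth_nth tnth_mktuple -/(inN f _) rmorphD. Qed.

Lemma shiftC c d i j (u : N) : shift c i (shift d j u) = shift d j (shift c i u).
Proof.
apply: (Nf_rmorph_ext (g := shift c i \o shift d j) (h := shift d j \o shift c i)).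
  by move=> a /=; rewrite !shift_funN.
by move=> k /=; rewrite !shift_sN !rmorphD /= !shift_sN !shift_funN addrAC.
Qed.

(** The operator s_i t_i^(-1), which represents - d/dt_i, so that
    s_{i,j} = d_i t_j. *)
Definition d_op (i : 'I_r) (u : N) : N := sN i * t_inv i u.

Lemma s_opE i j (u : N) : s_op i j u = d_op i (t_op j u).
Proof. by []. Qed.

Lemma t_opD j (u v : N) : t_op j (u + v) = t_op j u + t_op j v.
Proof. by rewrite /t_op rmorphD mulrDl. Qed.

Lemma t_invD j (u v : N) : t_inv j (u + v) = t_inv j u + t_inv j v.
Proof. by rewrite /t_inv rmorphD mulrDl. Qed.

Lemma t_op0 j : t_op j (0 : N) = 0.
Proof. by rewrite /t_op rmorph0 mul0r. Qed.

Lemma t_inv0 j : t_inv j (0 : N) = 0.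
Proof. by rewrite /t_inv rmorph0 mul0r. Qed.

Lemma d_op0 j : d_op j (0 : N) = 0.
Proof. by rewrite /d_op t_inv0 mulr0. Qed.

Lemma t_op1 j : t_op j (1 : N) = funN (f j).
Proof. by rewrite /t_op rmorph1 mul1r. Qed.

Lemma d_opD j (u v : N) : d_op j (u + v) = d_op j u + d_op j v.
Proof. by rewrite /d_op t_invD mulrDr. Qed.

Lemma t_op_fun j a (u : N) : t_op j (funN a * u) = funN a * t_op j u.
Proof. by rewrite /t_op rmorphM /= shift_funN mulrA. Qed.

Lemma t_inv_fun j a (u : N) : t_inv j (funN a * u) = funN a * t_inv j u.
Proof. by rewrite /t_inv rmorphM /= shift_funN mulrA. Qed.

Lemma d_op_fun j a (u : N) : d_op j (funN a * u) = funN a * d_op j u.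
Proof. by rewrite /d_op t_inv_fun mulrCA. Qed.

Lemma t_op_s i j (u : N) :
  t_op i (sN j * u) = sN j * t_op i u + t_op i u *+ (i == j).
Proof.
rewrite /t_op rmorphM /= shift_sN eq_sym.
by case: eqP => _; rewrite /= ?rmorph1 ?rmorph0 ?mulr1n ?mulr0n; ring.
Qed.

Lemma t_opC i j (u : N) : t_op i (t_op j u) = t_op j (t_op i u).
Proof. by rewrite /t_op !rmorphM /= !shift_inN shiftC mulrAC. Qed.

Lemma t_op_inv i j (u : N) : t_op i (t_inv j u) = t_inv j (t_op i u).
Proof. by apply: (can_inj (t_opK j)); rewrite t_invK -t_opC t_invK. Qed.

Lemma t_invC i j (u : N) : t_inv i (t_inv j u) = t_inv j (t_inv i u).
Proof. by apply: (can_inj (t_opK i)); rewrite t_invK t_op_inv t_invK. Qed.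

(** The Weyl algebra relation between t_i and - d/dt_j. *)
Lemma t_op_d i j (u : N) : t_op i (d_op j u) = d_op j (t_op i u) + u *+ (i == j).
Proof.
rewrite /d_op t_op_s -t_op_inv; congr (_ + _).
by case: eqP => // ->; rewrite t_invK.
Qed.

Lemma t_inv_s i j (u : N) : i != j -> t_inv i (sN j * u) = sN j * t_inv i u.
Proof.
move=> ij; apply: (can_inj (t_opK i)); rewrite t_invK t_op_s t_invK.
by rewrite (negbTE ij) mulr0n addr0.
Qed.

Lemma d_opC i j (u : N) : d_op i (d_op j u) = d_op j (d_op i u).
Proof.
have [->//|ij] := eqVneq i j.
by rewrite /d_op t_inv_s // t_inv_s 1?eq_sym // t_invC mulrCA.
Qed.

Lemma t_op_s_op k i j (u : N) :
  t_op k (s_op i j u) = s_op i j (t_op k u) + t_op j u *+ (k == i).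
Proof. by rewrite !s_opE t_op_d t_opC. Qed.

Lemma d_op_s_op k i j (u : N) :
  d_op k (s_op i j u) = s_op i j (d_op k u) - d_op i u *+ (j == k).
Proof.
rewrite !s_opE d_opC t_op_d d_opD.
by case: eqP => _; rewrite ?d_op0 addrK.
Qed.

Section VectorField.
Variable xi : {linear A -> A}.
Hypothesis xiM : is_derivation xi.

Lemma map_mpoly_derivation (p q : {mpoly A[r]}) :
  map_mpoly xi (p * q) = map_mpoly xi p * q + p * map_mpoly xi q.
Proof.
apply/mpolyP=> m; rewrite mcoeffD mcoeff_map_mpoly !mcoeffM.
rewrite raddf_sum -big_split /=; apply: eq_bigr => k _.
by rewrite xiM !mcoeff_map_mpoly.
Qed.

(** The power rule d(p^n) = n p^(n-1) dp, multiplied by p to avoid n - 1. *)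
Lemma map_mpoly_derivationX (p : {mpoly A[r]}) n :
  p * map_mpoly xi (p ^+ n) = (map_mpoly xi p * p ^+ n) *+ n.
Proof.
elim: n => [|n IH].
  by rewrite expr0 -mpolyC1 map_mpolyC /= derivation1 // mpolyC0 mulr0 mulr0n.
by rewrite exprS map_mpoly_derivation mulrDr mulrCA [p * (p * _)]mulrCA IH; ring.
Qed.

Lemma der_extD (u v : N) : der_ext xi (u + v) = der_ext xi u + der_ext xi v.
Proof.
move: u v; apply: FracP => p m; apply: FracP => q n.
rewrite FracD !der_extE // FracD; apply/FracE; exists 0%N; rewrite expr0 !mul1r.
rewrite !raddfD /= !map_mpoly_derivation.
have := map_mpoly_derivationX (prodf f) m.
have := map_mpoly_derivationX (prodf f) n.
set F := prodf f; set G := map_mpoly xi F.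
set Xn := map_mpoly xi (F ^+ n); set Xm := map_mpoly xi (F ^+ m) => en em.
set p' := map_mpoly xi p; set q' := map_mpoly xi q.
transitivity (F ^+ (m + n).+1 * (F * (F * Xn * p + F * F ^+ n * p'
  + (F * Xm * q + F * F ^+ m * q') - (G * (F ^+ n * p + F ^+ m * q)) *+ (m + n)))).
  by rewrite !addSn !addnS !exprS !exprD; ring.
by rewrite en em !exprS !exprD; ring.
Qed.

Lemma der_extM (u v : N) : der_ext xi (u * v) = der_ext xi u * v + u * der_ext xi v.
Proof.
move: u v; apply: FracP => p m; apply: FracP => q n.
rewrite FracM !der_extE // !FracM FracD; apply/FracE; exists 0%N; rewrite expr0 !mul1r.
by rewrite map_mpoly_derivation !addSn !addnS !exprS !exprD; ring.
Qed.

Lemma der_ext_fun a : der_ext xi (funN a) = funN (xi a).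
Proof.
rewrite der_extE //; apply/FracE; exists 0%N.
by rewrite map_mpolyC /= mulr0n; ring.
Qed.

Lemma der_ext_s i : der_ext xi (sN i) = 0.
Proof.
have X0 : map_mpoly xi ('X_i : {mpoly A[r]}) = 0.
  apply/mpolyP => m; rewrite mcoeff_map_mpoly mcoeffX mcoeff0.
  by case: eqP => _ /=; rewrite ?mulr1n ?mulr0n ?derivation1 ?linear0.
rewrite der_extE // X0; apply/FracE; exists 0%N.
by rewrite mulr0n; ring.
Qed.

Lemma shift_der_ext (c : int) j (u : N) :
  shift c%:~R j (der_ext xi u) = der_ext xi (shift c%:~R j u).
Proof.
pose g : {rmorphism N -> N} := shift c%:~R j.
apply: (Nf_derivation_ext (g := g) (D := fun u => shift c%:~R j (der_ext xi u))
  (E := fun u => der_ext xi (shift c%:~R j u))) => [v w|v w|v w|v w|a|i].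
- by rewrite der_extD rmorphD.
- by rewrite rmorphD der_extD.
- by rewrite der_extM rmorphD !rmorphM.
- by rewrite rmorphM der_extM.
- by rewrite shift_funN !der_ext_fun shift_funN.
rewrite der_ext_s rmorph0 shift_sN der_extD der_ext_s add0r der_ext_fun.
have xic : xi c%:~R = 0 by rewrite raddfMz /= derivation1 // mul0rz.
by case: ifP => _; rewrite ?xic ?linear0 rmorph0.
Qed.

(** The logarithmic derivative of prod_i f_i^(s_i) along xi. *)
Definition dlog : N := \sum_i sN i * (funN (xi (f i)) * finv f i).

Lemma vfield_actE (u : N) : vfield_act xi u = der_ext xi u + u * dlog.
Proof. by []. Qed.

Lemma vfield_actD (u v : N) : vfield_act xi (u + v) = vfield_act xi u + vfield_act xi v.
Proof. by rewrite !vfield_actE der_extD mulrDl addrACA. Qed.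

Lemma vfield_actM (u v : N) : vfield_act xi (u * v) = der_ext xi u * v + u * vfield_act xi v.
Proof. by rewrite !vfield_actE der_extM mulrDr mulrA addrA. Qed.

Lemma vfield_act0 : vfield_act xi (0 : N) = 0.
Proof. by apply: (addIr (vfield_act xi 0)); rewrite -vfield_actD !add0r. Qed.

Lemma shift_dlog j : shift 1 j dlog = dlog + funN (xi (f j)) * finv f j.
Proof.
rewrite /dlog (bigD1 j) //= rmorphD rmorphM /= shift_sN eqxx.
rewrite rmorph1 rmorphM /= shift_funN shift_finv mulrDl mul1r -[in RHS]addrA.
rewrite -!addrA; congr (_ + _); rewrite addrC; congr (_ + _).
rewrite rmorph_sum; apply: eq_bigr => i ij /=.
by rewrite !rmorphM /= shift_sN (negbTE ij) rmorph0 addr0 shift_funN shift_finv.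
Qed.

(** The shift of s_j by 1 changes the logarithmic derivative by xi(f_j) / f_j,
    which is the term produced by xi on the factor f_j of t_j. *)
Lemma t_op_vfield j (u : N) : t_op j (vfield_act xi u) = vfield_act xi (t_op j u).
Proof.
rewrite !vfield_actE /t_op rmorphD rmorphM /= shift_dlog -/(funN (f j)).
have := shift_der_ext 1 j u; rewrite mulr1z => ->.
rewrite der_extM der_ext_fun.
transitivity (der_ext xi (shift 1 j u) * funN (f j)
  + shift 1 j u * dlog * funN (f j)
  + shift 1 j u * funN (xi (f j)) * (funN (f j) * finv f j)); first by ring.
by rewrite funN_finv; ring.
Qed.

Lemma t_inv_vfield j (u : N) : t_inv j (vfield_act xi u) = vfield_act xi (t_inv j u).
Proof. by apply: (can_inj (t_opK j)); rewrite t_invK t_op_vfield t_invK. Qed.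

Lemma d_op_vfield j (u : N) : d_op j (vfield_act xi u) = vfield_act xi (d_op j u).
Proof. by rewrite /d_op vfield_actM der_ext_s mul0r add0r t_inv_vfield. Qed.

End VectorField.
End TwistedModule.

(** * The V-filtration *)

Section Filtration.
Variables (C : fieldType) (A : comAlgType C) (r : nat) (f : 'I_r -> A).
Local Notation N := (Nf f).

Record DS_submodule (P : N -> Prop) : Prop := DSSubmodule {
  DS_subD : forall u v, P u -> P v -> P (u + v);
  DS_sub_fun : forall a u, P u -> P (funN f a * u);
  DS_sub_vfield : forall (xi : {linear A -> A}) u,
    is_derivation xi -> P u -> P (vfield_act xi u);
  DS_sub_s : forall i j u, P u -> P (s_op i j u) }.

Lemma DS_subN P u : DS_submodule P -> P u -> P (- u).
Proof.
move=> sP Pu; have := DS_sub_fun sP (-1) Pu.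
by rewrite rmorphN1 mulN1r.
Qed.

Lemma DS_sub0 P u : DS_submodule P -> P u -> P 0.
Proof. by move=> sP Pu; rewrite -(mul0r u) -(rmorph0 (funN f)); apply: DS_sub_fun. Qed.

Lemma DS_sub_op P Q u : DS_submodule P -> DS_op Q -> P u -> P (Q u).
Proof.
move=> sP DQ; elim: DQ u => {Q} [a|xi xiM|i j|Q Q' _ hQ _ hQ'|Q _ hQ|Q Q' _ hQ _ hQ'] u Pu.
- exact: DS_sub_fun.
- exact: DS_sub_vfield.
- exact: DS_sub_s.
- by apply: DS_subD; [|apply: hQ|apply: hQ'].
- by apply: DS_subN; [|apply: hQ].
- by apply: hQ; apply: hQ'.
Qed.

(** V^1: an inductive generation of the submodule, rather than the sums of
    P_k t_k f^s, makes stability properties provable on generators. *)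
Inductive V1 : N -> Prop :=
| V1_t k : V1 (t_op k 1)
| V1_0 : V1 0
| V1_D u v : V1 u -> V1 v -> V1 (u + v)
| V1_fun a u : V1 u -> V1 (funN f a * u)
| V1_vfield (xi : {linear A -> A}) u : is_derivation xi -> V1 u -> V1 (vfield_act xi u)
| V1_s i j u : V1 u -> V1 (s_op i j u).

Lemma V1_submodule : DS_submodule V1.
Proof. by split; [exact: V1_D|exact: V1_fun|exact: V1_vfield|exact: V1_s]. Qed.

Lemma DS_opD P (u v : N) : DS_op P -> P (u + v) = P u + P v.
Proof.
move=> DP; elim: DP u v => {P} [a|xi xiM|i j|P Q _ hP _ hQ|P _ hP|P Q _ hP _ hQ] u v.
- exact: mulrDr.
- exact: vfield_actD.
- by rewrite !s_opE t_opD d_opD.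
- by rewrite hP hQ addrACA.
- by rewrite hP opprD.
- by rewrite hQ hP.
Qed.

Lemma DS_op0 P : DS_op P -> P (0 : N) = 0.
Proof. by move=> DP; apply: (addIr (P 0)); rewrite -DS_opD // !add0r. Qed.

Lemma functional_equationE b :
  functional_equation f b <-> V1 (inN f (eval_s A r b)).
Proof.
split=> [[P [DP ]]|].
  rewrite mulr1 => ->; elim/big_ind: _ => [||k _]; first exact: V1_0.
    exact: V1_D.
  by apply: (DS_sub_op V1_submodule (DP k)); apply: V1_t.
suff h : forall u, V1 u -> exists P : 'I_r -> N -> N,
    (forall k, DS_op (P k)) /\ u = \sum_k P k (t_op k 1).
  by move=> /h[P [DP e]]; exists P; rewrite mulr1.
move=> u; elim=> {u} [k||u v _ [P [DP ->]] _ [Q [DQ ->]]|a u _ [P [DP ->]]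
    |xi u xiM _ [P [DP ->]]|i j u _ [P [DP ->]]].
- exists (fun l u => funN f (if l == k then 1 else 0) * u).
  split=> [l|]; first exact: DS_fun.
  rewrite (bigD1 k) //= eqxx rmorph1 mul1r big1 ?addr0 // => l /negbTE ->.
  by rewrite rmorph0 mul0r.
- exists (fun _ u => funN f 0 * u).
  by split=> [l|]; [exact: DS_fun|rewrite big1 // => l _; rewrite rmorph0 mul0r].
- exists (fun k u => P k u + Q k u); split=> [k|]; first exact: DS_add.
  by rewrite big_split.
- exists (fun k u => funN f a * P k u); split=> [k|]; last by rewrite mulr_sumr.
  exact: (DS_comp (DS_fun f a) (DP k)).
- exists (fun k u => vfield_act xi (P k u)); split=> [k|].
    exact: (DS_comp (DS_vfield f xiM) (DP k)).
  by apply: (big_morph _ _ (vfield_act0 f xiM)) => v w; apply: vfield_actD.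
- exists (fun k u => s_op i j (P k u)); split=> [k|].
    exact: (DS_comp (DS_s f i j) (DP k)).
  apply: big_morph => [v w|]; first by rewrite (DS_opD _ _ (DS_s f i j)).
  exact: (DS_op0 (DS_s f i j)).
Qed.

(** [Vup n] is V^(1+n) and [Vdown n] is V^(1-n).  Both are defined from V^1 as the
    largest candidates: membership is then a universally quantified condition, and
    no normal ordering of operators is needed to check stability. *)
Fixpoint Vup (n : nat) (u : N) : Prop :=
  if n is n'.+1 then Vup n' u /\ forall i, Vup n' (d_op i u) else V1 u.

Fixpoint Vdown (n : nat) (u : N) : Prop :=
  if n is n'.+1 then forall i, Vdown n' (t_op i u) else V1 u.

Lemma Vup_submodule n : DS_submodule (Vup n).
Proof.
elim: n => [|n IH]; first exact: V1_submodule.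
split=> [u v [u1 u2] [v1 v2]|a u [u1 u2]|xi u xiM [u1 u2]|i j u [u1 u2]].
- split=> [|i]; first exact: (DS_subD IH).
  by rewrite d_opD; apply: (DS_subD IH (u2 i) (v2 i)).
- split=> [|i]; first exact: (DS_sub_fun IH).
  by rewrite d_op_fun; apply: (DS_sub_fun IH _ (u2 i)).
- split=> [|i]; first exact: (DS_sub_vfield IH).
  by rewrite d_op_vfield //; apply: (DS_sub_vfield IH xiM (u2 i)).
- split=> [|k]; first exact: (DS_sub_s IH).
  rewrite d_op_s_op; apply: (DS_subD IH); first exact: (DS_sub_s IH _ _ (u2 k)).
  case: eqP => _ /=; rewrite ?mulr1n ?mulr0n.
    exact: (DS_subN IH (u2 i)).
  by rewrite oppr0; apply: (DS_sub0 IH u1).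
Qed.

Lemma Vdown_submodule n : DS_submodule (Vdown n).
Proof.
elim: n => [|n IH]; first exact: V1_submodule.
split=> [u v hu hv|a u hu|xi u xiM hu|i j u hu] k.
- by rewrite t_opD; apply: (DS_subD IH (hu k) (hv k)).
- by rewrite t_op_fun; apply: (DS_sub_fun IH _ (hu k)).
- by rewrite t_op_vfield //; apply: (DS_sub_vfield IH xiM (hu k)).
- rewrite t_op_s_op; apply: (DS_subD IH); first exact: (DS_sub_s IH _ _ (hu k)).
  case: eqP => _ /=; rewrite ?mulr1n ?mulr0n; first exact: hu.
  exact: (DS_sub0 IH (hu k)).
Qed.

Lemma Vup_V1 n u : Vup n u -> V1 u.
Proof. by elim: n u => // n IH u [/IH]. Qed.

(** t_k d_i u = s_{i,k} u + delta_{ik} u, and the filtration is stable under the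
    degree 0 operators s_{i,k}. *)
Lemma Vdown_d n i u : Vdown n u -> Vdown n.+1 (d_op i u).
Proof.
move=> hu k; rewrite t_op_d -s_opE; apply: (DS_subD (Vdown_submodule n)).
  exact: (DS_sub_s (Vdown_submodule n)).
case: eqP => _ /=; rewrite ?mulr1n ?mulr0n //.
exact: (DS_sub0 (Vdown_submodule n) hu).
Qed.

Lemma V1_t_op k u : V1 u -> V1 (t_op k u).
Proof.
move=> V1u; elim: V1u k => {u} [l||u v _ hu _ hv|a u _ hu|xi u xiM _ hu|i j u _ hu] k.
- by rewrite t_op1 -[funN f _]mulr1 t_op_fun; apply: V1_fun; apply: V1_t.
- by rewrite t_op0; apply: V1_0.
- by rewrite t_opD; apply: V1_D.
- by rewrite t_op_fun; apply: V1_fun.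
- by rewrite t_op_vfield //; apply: V1_vfield.
- rewrite t_op_s_op; apply: V1_D; first exact: V1_s.
  by case: eqP => _ /=; rewrite ?mulr1n ?mulr0n //; apply: V1_0.
Qed.

(** d_j t_i = s_{j,i} preserves each step of the filtration. *)
Lemma Vup_t n i u : Vup n u -> Vup n.+1 (t_op i u).
Proof.
elim: n u => [|n IH] u hu.
  by split=> [|j]; [exact: V1_t_op|exact: V1_s].
split=> [|j]; first by apply: IH; case: hu.
exact: (DS_sub_s (Vup_submodule n.+1)).
Qed.

Lemma Vdown1 : Vdown 1 1.
Proof. by move=> i; apply: V1_t. Qed.

End Filtration.

(** * Pull-back along a projection *)

Section Pullback.
Variables (C : fieldType) (A T : comAlgType C) (rho : {lrmorphism A -> T}).
Variables (r n : nat) (f : 'I_r -> A) (h : 'I_n -> T) (sigma : 'I_r -> 'I_n).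
Hypothesis sigma_inj : injective sigma.
Hypothesis h_sigma : forall i, h (sigma i) = rho (f i).

Definition is_pullback (iota : Nf f -> Nf h) : Prop :=
  (forall a, iota (funN f a) = funN h (rho a)) /\
  (forall i, iota (sN f i) = sN h (sigma i)).

(** The universal property of the localization, applied to the substitution that
    sends s_i to s_(sigma i): the image of the product of the f_i is invertible
    because each h_(sigma i) is. *)
Lemma pullback_exists : exists iota : {rmorphism Nf f -> Nf h}, is_pullback iota.
Proof.
pose rhoC : {rmorphism A -> {mpoly T[n]}} := @mpolyC n T \o rho.
pose phi : {rmorphism {mpoly A[r]} -> Nf h} :=
  inN h \o mmap rhoC (fun i => 'X_(sigma i)).
pose y : Nf h := \prod_i finv h (sigma i).
have yF : phi (prodf f) * y = 1.
  rewrite /phi /= mmapC /= rmorph_prod.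
  rewrite -[inN h _]/(funN h _) [funN h _]rmorph_prod -big_split big1 // => i _ /=.
  by rewrite -h_sigma funN_finv.
have zm := loc_extend_zmod_morphism yF; have mm := loc_extend_monoid_morphism yF.
pose iota : {rmorphism Nf f -> Nf h} := HB.pack (loc_extend phi y)
  (GRing.isZmodMorphism.Build _ _ _ zm) (GRing.isMonoidMorphism.Build _ _ _ mm).
exists iota; split=> [a|i] /=.
  by rewrite /funN [LHS]loc_extendE // mulr1 /= mmapC.
by rewrite /sN [LHS]loc_extendE // mulr1 /= mmapX mmap1U.
Qed.

Variable iota : {rmorphism Nf f -> Nf h}.
Hypothesis iotaP : is_pullback iota.

Lemma pullback_finv i : iota (finv f i) = finv h (sigma i).
Proof.
apply: (inverse_unique (x := funN h (h (sigma i)))); last exact: funN_finv.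
by rewrite h_sigma -(proj1 iotaP) -rmorphM funN_finv rmorph1.
Qed.

Lemma pullback_shift c j u :
  shift (rho c) (sigma j) (iota u) = iota (shift c j u).
Proof.
apply: (Nf_rmorph_ext (g := shift (rho c) (sigma j) \o iota)
                      (h := iota \o shift c j)) => [a|i] /=.
  by rewrite (proj1 iotaP) !shift_funN (proj1 iotaP).
rewrite (proj2 iotaP) !shift_sN rmorphD /= (proj1 iotaP) (proj2 iotaP).
rewrite (inj_eq sigma_inj); congr (_ + funN h _).
by case: ifP => // _; rewrite rmorph0.
Qed.

Lemma pullback_shift_fixed c k u : (forall i, sigma i != k) ->
  shift c k (iota u) = iota u.
Proof.
move=> ksigma.
apply: (Nf_rmorph_ext (g := shift c k \o iota) (h := iota)) => [a|i] /=.
  by rewrite (proj1 iotaP) shift_funN.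
by rewrite (proj2 iotaP) shift_sN (negbTE (ksigma i)) rmorph0 addr0.
Qed.

Lemma pullback_t_op j u w : shift 1 (sigma j) w = w ->
  t_op (sigma j) (iota u * w) = iota (t_op j u) * w.
Proof.
move=> hw; rewrite /t_op -/(funN _ _) -/(funN _ _) !rmorphM /= hw h_sigma.
have := pullback_shift 1 j u; rewrite rmorph1 => ->.
by rewrite (proj1 iotaP) mulrAC.
Qed.

Lemma pullback_d_op j u w : shift (-1) (sigma j) w = w ->
  d_op (sigma j) (iota u * w) = iota (d_op j u) * w.
Proof.
move=> hw; rewrite /d_op /t_inv !rmorphM /= hw (proj2 iotaP) pullback_finv.
have := pullback_shift (-1) j u; rewrite rmorphN1 => ->.
by ring.
Qed.

(** Both sides are derivations along iota. *)
Lemma pullback_der_ext (Xi : {linear T -> T}) (K : nat)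
    (xi : 'I_K -> {linear A -> A}) (c : 'I_K -> T) :
  is_derivation Xi -> (forall k, is_derivation (xi k)) ->
  (forall a, Xi (rho a) = \sum_k rho (xi k a) * c k) ->
  forall u, der_ext Xi (iota u) = \sum_k iota (der_ext (xi k) u) * funN h (c k).
Proof.
move=> XiM xiM XiE.
apply: (Nf_derivation_ext (g := iota) (D := fun u => der_ext Xi (iota u))
  (E := fun u => \sum_k iota (der_ext (xi k) u) * funN h (c k)))
  => [u v|u v|u v|u v|a|i].
- by rewrite rmorphD der_extD.
- by rewrite -big_split; apply: eq_bigr => k _; rewrite der_extD // rmorphD mulrDl.
- by rewrite rmorphM der_extM.
- rewrite mulr_suml mulr_sumr -big_split; apply: eq_bigr => k _ /=.
  by rewrite der_extM // rmorphD !rmorphM; ring.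
- rewrite (proj1 iotaP) der_ext_fun // XiE rmorph_sum; apply: eq_bigr => k _ /=.
  by rewrite der_ext_fun // (proj1 iotaP) rmorphM.
- rewrite (proj2 iotaP) der_ext_s // big1 // => k _.
  by rewrite der_ext_s // rmorph0 mul0r.
Qed.

Lemma pullback_dlog (Xi : {linear T -> T}) (K : nat)
    (xi : 'I_K -> {linear A -> A}) (c : 'I_K -> T) :
  (forall a, Xi (rho a) = \sum_k rho (xi k a) * c k) ->
  \sum_i sN h (sigma i) * (funN h (Xi (h (sigma i))) * finv h (sigma i)) =
  \sum_k iota (dlog f (xi k)) * funN h (c k).
Proof.
move=> XiE; under [RHS]eq_bigr do rewrite rmorph_sum mulr_suml.
rewrite exchange_big; apply: eq_bigr => i _ /=.
rewrite h_sigma XiE rmorph_sum mulr_suml mulr_sumr; apply: eq_bigr => k _ /=.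
by rewrite !rmorphM /= (proj1 iotaP) (proj2 iotaP) pullback_finv; ring.
Qed.

End Pullback.

(** * The V-filtration of a product *)

Section Product.
Variables (C : fieldType) (A B T : comAlgType C).
Variables (i1 : {lrmorphism A -> T}) (i2 : {lrmorphism B -> T}).
Variables (r r' : nat) (f : 'I_r -> A) (g : 'I_r' -> B).
Local Notation h := (product_map i1 i2 f g).
Variables (iota1 : {rmorphism Nf f -> Nf h}) (iota2 : {rmorphism Nf g -> Nf h}).
Hypothesis iota1P : is_pullback i1 (lshift r') iota1.
Hypothesis iota2P : is_pullback i2 (@rshift r r') iota2.

Lemma product_map_l i : h (lshift r' i) = i1 (f i).
Proof. by rewrite /product_map (unsplitK (inl i)). Qed.

Lemma product_map_r j : h (rshift r j) = i2 (g j).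
Proof. by rewrite /product_map (unsplitK (inr j)). Qed.

Lemma shift_l_iota2 c i v : shift c (lshift r' i) (iota2 v) = iota2 v.
Proof.
by apply: (pullback_shift_fixed iota2P) => j; rewrite eq_sym eq_lrshift.
Qed.

Lemma shift_r_iota1 c j u : shift c (rshift r j) (iota1 u) = iota1 u.
Proof.
by apply: (pullback_shift_fixed iota1P) => i; rewrite eq_lrshift.
Qed.

Lemma t_op_l i u v : t_op (lshift r' i) (iota1 u * iota2 v) = iota1 (t_op i u) * iota2 v.
Proof.
exact: (pullback_t_op (@lshift_inj r r') product_map_l iota1P u (shift_l_iota2 1 i v)).
Qed.

Lemma d_op_l i u v : d_op (lshift r' i) (iota1 u * iota2 v) = iota1 (d_op i u) * iota2 v.
Proof.
exact: (pullback_d_op (@lshift_inj r r') product_map_l iota1P u (shift_l_iota2 (-1) i v)).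
Qed.

Lemma t_op_r j u v : t_op (rshift r j) (iota1 u * iota2 v) = iota1 u * iota2 (t_op j v).
Proof.
rewrite mulrC [RHS]mulrC.
exact: (pullback_t_op (@rshift_inj r r') product_map_r iota2P v (shift_r_iota1 1 j u)).
Qed.

Lemma d_op_r j u v : d_op (rshift r j) (iota1 u * iota2 v) = iota1 u * iota2 (d_op j v).
Proof.
rewrite mulrC [RHS]mulrC.
exact: (pullback_d_op (@rshift_inj r r') product_map_r iota2P v (shift_r_iota1 (-1) j u)).
Qed.

(** The Leibniz rule, once Xi is decomposed along the two factors. *)
Lemma vfield_act_product (Xi : {linear T -> T})
    (K : nat) (xi : 'I_K -> {linear A -> A}) (b : 'I_K -> B)
    (L : nat) (eta : 'I_L -> {linear B -> B}) (a : 'I_L -> A) u v :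
  is_derivation Xi ->
  (forall k, is_derivation (xi k)) -> (forall l, is_derivation (eta l)) ->
  (forall x, Xi (i1 x) = \sum_k i1 (xi k x) * i2 (b k)) ->
  (forall y, Xi (i2 y) = \sum_l i2 (eta l y) * i1 (a l)) ->
  vfield_act Xi (iota1 u * iota2 v) =
    \sum_k iota1 (vfield_act (xi k) u) * iota2 (funN g (b k) * v) +
    \sum_l iota1 (funN f (a l) * u) * iota2 (vfield_act (eta l) v).
Proof.
move=> XiM xiM etaM Xi1 Xi2.
rewrite vfield_actE der_extM // (pullback_der_ext iota1P XiM xiM Xi1).
rewrite (pullback_der_ext iota2P XiM etaM Xi2) /dlog big_split_ord /=.
rewrite (pullback_dlog product_map_l iota1P Xi1).
rewrite (pullback_dlog product_map_r iota2P Xi2).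
transitivity (\sum_k iota1 (der_ext (xi k) u) * iota2 (funN g (b k) * v)
  + \sum_l iota1 (funN f (a l) * u) * iota2 (der_ext (eta l) v)
  + (\sum_k iota1 (u * dlog f (xi k)) * iota2 (funN g (b k) * v)
  + \sum_l iota1 (funN f (a l) * u) * iota2 (v * dlog g (eta l)))).
  rewrite mulrDr !mulr_suml !mulr_sumr.
  congr (_ + _ + (_ + _)); apply: eq_bigr => k _;
    rewrite !rmorphM /= ?(proj1 iota1P) ?(proj1 iota2P); ring.
rewrite addrACA -!big_split; congr (_ + _); apply: eq_bigr => k _ /=.
  by rewrite vfield_actE rmorphD mulrDl.
by rewrite vfield_actE rmorphD mulrDr.
Qed.

Hypothesis prodT : product_ring i1 i2.

Lemma V1_iota1 u : V1 u -> V1 (iota1 u).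
Proof.
elim=> {u} [k||u v _ hu _ hv|a u _ hu|xi u xiM _ hu|i j u _ hu].
- have := t_op_l k 1 1; rewrite !rmorph1 !mulr1 => <-; exact: V1_t.
- by rewrite rmorph0; apply: V1_0.
- by rewrite rmorphD; apply: V1_D.
- by rewrite rmorphM /= (proj1 iota1P); apply: V1_fun.
- have [Xi [XiM XiE]] := extend_derivation prodT xiM.
  have := @vfield_act_product Xi 1 (fun=> xi) (fun=> 1) 0 (fun=> \0) (fun=> 0) u 1.
  rewrite big_ord1 big_ord0 addr0 !rmorph1 !mulr1 rmorph1 mulr1 => <- //.
  + exact: V1_vfield.
  + by case.
  + by move=> x; rewrite big_ord1 /= -[i1 x]mulr1 -(rmorph1 i2) XiE.
  + move=> y; rewrite big_ord0 -[i2 y]mul1r -(rmorph1 i1) XiE derivation1 //.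
    by rewrite rmorph0 mul0r.
- have := d_op_l i (t_op j u) 1; rewrite rmorph1 !mulr1 => <-.
  have := t_op_l j u 1; rewrite rmorph1 !mulr1 => <-.
  exact: V1_s.
Qed.

Lemma V1_iota2 v : V1 v -> V1 (iota2 v).
Proof.
elim=> {v} [k||u v _ hu _ hv|b v _ hv|eta v etaM _ hv|i j v _ hv].
- have := t_op_r k 1 1; rewrite !rmorph1 !mul1r => <-; exact: V1_t.
- by rewrite rmorph0; apply: V1_0.
- by rewrite rmorphD; apply: V1_D.
- by rewrite rmorphM /= (proj1 iota2P); apply: V1_fun.
- have [Xi [XiM XiE]] := extend_derivation (product_ring_sym prodT) etaM.
  have := @vfield_act_product Xi 0 (fun=> \0) (fun=> 0) 1 (fun=> eta) (fun=> 1) 1 v.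
  rewrite big_ord1 big_ord0 add0r !rmorph1 !mul1r rmorph1 mul1r => <- //.
  + exact: V1_vfield.
  + by case.
  + move=> x; rewrite big_ord0 -[i1 x]mul1r -(rmorph1 i2) XiE derivation1 //.
    by rewrite rmorph0 mul0r.
  + by move=> y; rewrite big_ord1 /= -[i2 y]mulr1 -(rmorph1 i1) XiE.
- have := d_op_r i 1 (t_op j v); rewrite rmorph1 !mul1r => <-.
  have := t_op_r j 1 v; rewrite rmorph1 !mul1r => <-.
  exact: V1_s.
Qed.

(** The sum over all integers j of V^j_f (x) V^(1-j)_g: the first constructor gives
    j = n + 1 and the second j = - n. *)
Inductive V1prod : Nf h -> Prop :=
| V1prod_ud n u v : Vup n u -> Vdown n.+1 v -> V1prod (iota1 u * iota2 v)
| V1prod_du n u v : Vdown n.+1 u -> Vup n v -> V1prod (iota1 u * iota2 v)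
| V1prod_0 : V1prod 0
| V1prod_D w w' : V1prod w -> V1prod w' -> V1prod (w + w').

Lemma V1prod_ind_additive (D : Nf h -> Nf h) :
  D 0 = 0 -> (forall w w', D (w + w') = D w + D w') ->
  (forall n u v, Vup n u -> Vdown n.+1 v -> V1prod (D (iota1 u * iota2 v))) ->
  (forall n u v, Vdown n.+1 u -> Vup n v -> V1prod (D (iota1 u * iota2 v))) ->
  forall w, V1prod w -> V1prod (D w).
Proof.
move=> D0 DD Dud Ddu w; elim=> {w} [n u v hu hv|n u v hu hv||w w' _ hw _ hw'].
- exact: Dud hu hv.
- exact: Ddu hu hv.
- by rewrite D0; apply: V1prod_0.
- by rewrite DD; apply: V1prod_D.
Qed.

(** d_i lowers by one the index of the first factor and t_j raises by one that of
    the second.  From V^1_f (x) V^0_g one passes to V^0_f (x) V^1_g, hence from one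
    constructor to the other. *)
Lemma V1prod_mixed1 i j w : V1prod w -> V1prod (d_op (lshift r' i) (t_op (rshift r j) w)).
Proof.
apply: (V1prod_ind_additive (D := fun w => d_op (lshift r' i) (t_op (rshift r j) w)))
  => [|w1 w2|n u v hu hv|n u v hu hv] /=.
- by rewrite t_op0 d_op0.
- by rewrite t_opD d_opD.
- rewrite t_op_r d_op_l; case: n hu hv => [|n] hu hv.
    apply: (V1prod_du (n := 0)); [exact: Vdown_d|exact: hv j].
  by apply: (V1prod_ud (n := n)); [exact: (proj2 hu i)|exact: hv j].
- rewrite t_op_r d_op_l; apply: (V1prod_du (n := n.+1)).
    exact: Vdown_d.
  exact: Vup_t.
Qed.

Lemma V1prod_mixed2 i j w : V1prod w -> V1prod (d_op (rshift r j) (t_op (lshift r' i) w)).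
Proof.
apply: (V1prod_ind_additive (D := fun w => d_op (rshift r j) (t_op (lshift r' i) w)))
  => [|w1 w2|n u v hu hv|n u v hu hv] /=.
- by rewrite t_op0 d_op0.
- by rewrite t_opD d_opD.
- rewrite t_op_l d_op_r; apply: (V1prod_ud (n := n.+1)).
    exact: Vup_t.
  exact: Vdown_d.
- rewrite t_op_l d_op_r; case: n hu hv => [|n] hu hv.
    apply: (V1prod_ud (n := 0)); [exact: hu i|exact: Vdown_d].
  by apply: (V1prod_du (n := n)); [exact: hu i|exact: (proj2 hv j)].
Qed.

Hypotheses (ftA : finite_type A) (ftB : finite_type B).

Lemma V1prod_submodule : DS_submodule V1prod.
Proof.
split=> [w w'|t w|Xi w XiM|i j w].
- exact: V1prod_D.
- move=> hw; move: t; apply: (tensor_ind prodT) => [|x y hx hy|a b].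
  + by rewrite rmorph0 mul0r; apply: V1prod_0.
  + by rewrite rmorphD mulrDl; apply: V1prod_D.
  move: w hw; apply: (V1prod_ind_additive (D := fun w => funN h (i1 a * i2 b) * w))
  => [|w1 w2|n u v hu hv|n u v hu hv] /=.
  + by rewrite mulr0.
  + by rewrite mulrDr.
  + rewrite rmorphM /= -(proj1 iota1P) -(proj1 iota2P) mulrACA -!rmorphM.
    apply: (V1prod_ud (n := n)).
      exact: (DS_sub_fun (Vup_submodule f n)).
    exact: (DS_sub_fun (Vdown_submodule g n.+1)).
  + rewrite rmorphM /= -(proj1 iota1P) -(proj1 iota2P) mulrACA -!rmorphM.
    apply: (V1prod_du (n := n)).
      exact: (DS_sub_fun (Vdown_submodule f n.+1)).
    exact: (DS_sub_fun (Vup_submodule g n)).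
- have [K [xi [b [xiM Xi1]]]] := decompose_derivation prodT ftA XiM.
  have [L [eta [a [etaM Xi2]]]] :=
    decompose_derivation (product_ring_sym prodT) ftB XiM.
  move: w; apply: (V1prod_ind_additive (D := fun w => vfield_act Xi w))
  => [|w1 w2|n u v hu hv|n u v hu hv] /=.
  + exact: vfield_act0.
  + exact: vfield_actD.
  + rewrite (vfield_act_product u v XiM xiM etaM Xi1 Xi2); apply: V1prod_D.
      apply: (big_ind V1prod V1prod_0 V1prod_D) => k _; apply: (V1prod_ud (n := n)).
        exact: (DS_sub_vfield (Vup_submodule f n) (xiM k)).
      exact: (DS_sub_fun (Vdown_submodule g n.+1)).
    apply: (big_ind V1prod V1prod_0 V1prod_D) => l _; apply: (V1prod_ud (n := n)).
      exact: (DS_sub_fun (Vup_submodule f n)).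
    exact: (DS_sub_vfield (Vdown_submodule g n.+1) (etaM l)).
  + rewrite (vfield_act_product u v XiM xiM etaM Xi1 Xi2); apply: V1prod_D.
      apply: (big_ind V1prod V1prod_0 V1prod_D) => k _; apply: (V1prod_du (n := n)).
        exact: (DS_sub_vfield (Vdown_submodule f n.+1) (xiM k)).
      exact: (DS_sub_fun (Vup_submodule g n)).
    apply: (big_ind V1prod V1prod_0 V1prod_D) => l _; apply: (V1prod_du (n := n)).
      exact: (DS_sub_fun (Vdown_submodule f n.+1)).
    exact: (DS_sub_vfield (Vup_submodule g n) (etaM l)).
- have addE D : (forall n u v, Vup n u -> Vdown n.+1 v -> V1prod (D (iota1 u * iota2 v))) ->
    (forall n u v, Vdown n.+1 u -> Vup n v -> V1prod (D (iota1 u * iota2 v))) ->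
    D =1 @s_op _ _ _ h i j -> V1prod w -> V1prod (D w).
    move=> h1 h2 DE; apply: (V1prod_ind_additive (D := D)) => //.
      by rewrite DE s_opE t_op0 d_op0.
    by move=> w1 w2; rewrite !DE !s_opE t_opD d_opD.
  case: (split_ordP i) addE => i' ->; case: (split_ordP j) => j' -> addE.
  + apply: addE => // n u v hu hv; rewrite s_opE t_op_l d_op_l.
      apply: (V1prod_ud (n := n)) => //.
      exact: (DS_sub_s (Vup_submodule f n)).
    apply: (V1prod_du (n := n)) => //.
    exact: (DS_sub_s (Vdown_submodule f n.+1)).
  + exact: V1prod_mixed1.
  + exact: V1prod_mixed2.
  + apply: addE => // n u v hu hv; rewrite s_opE t_op_r d_op_r.
      apply: (V1prod_ud (n := n)) => //.
      exact: (DS_sub_s (Vdown_submodule g n.+1)).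
    apply: (V1prod_du (n := n)) => //.
    exact: (DS_sub_s (Vup_submodule g n)).
Qed.

(** The generators t_k h^s lie in V^1_f (x) V^0_g or in V^0_f (x) V^1_g. *)
Lemma V1_V1prod w : V1 w -> V1prod w.
Proof.
have sub := V1prod_submodule.
elim=> {w} [k||w w' _ hw _ hw'|a w _ hw|xi w xiM _ hw|i j w _ hw].
- case: (split_ordP k) => k' ->.
    have := t_op_l k' 1 1; rewrite !rmorph1 !mulr1 => ->.
    rewrite -[iota1 _]mulr1 -(rmorph1 iota2).
    by apply: (V1prod_ud (n := 0)); [apply: V1_t|apply: Vdown1].
  have := t_op_r k' 1 1; rewrite !rmorph1 !mul1r => ->.
  rewrite -[iota2 _]mul1r -(rmorph1 iota1).
  by apply: (V1prod_du (n := 0)); [apply: Vdown1|apply: V1_t].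
- exact: V1prod_0.
- exact: V1prod_D.
- exact: (DS_sub_fun sub).
- exact: (DS_sub_vfield sub).
- exact: (DS_sub_s sub).
Qed.

End Product.

(** * Functionals on the modules *)

Section Functionals.
Variables (C : fieldType) (A : comAlgType C) (r : nat) (f : 'I_r -> A).
Local Notation N := (Nf f).

Definition cstN (c : C) : N := funN f c%:A.

Lemma cstN_zmod_morphism : zmod_morphism cstN.
Proof. by move=> c d; rewrite /cstN scalerBl rmorphB. Qed.

Lemma cstN_monoid_morphism : monoid_morphism cstN.
Proof.
by split=> [|c d]; rewrite /cstN ?scale1r ?rmorph1 // -rmorphM -scalerAl mul1r scalerA.
Qed.

HB.instance Definition _ :=
  GRing.isZmodMorphism.Build C N cstN cstN_zmod_morphism.
HB.instance Definition _ :=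
  GRing.isMonoidMorphism.Build C N cstN cstN_monoid_morphism.

Definition functional (phi : N -> C) : Prop :=
  (forall u v, phi (u + v) = phi u + phi v) /\
  (forall c u, phi (cstN c * u) = c * phi u).

Lemma functional0 phi : functional phi -> phi 0 = 0.
Proof. by case=> phiD _; apply: (addIr (phi 0)); rewrite -phiD !add0r. Qed.

(** A copy of [Nf f] that carries the structure of vector space over C. *)
Definition NfMod : Type := N.
HB.instance Definition _ := GRing.Zmodule.copy NfMod N.

Lemma NfMod_scalerA (c d : C) (u : NfMod) : cstN c * (cstN d * u) = cstN (c * d) * u.
Proof. by rewrite rmorphM mulrA. Qed.
Lemma NfMod_scale1r : left_id 1 (fun c (u : NfMod) => cstN c * u : NfMod).
Proof. by move=> u; rewrite rmorph1 mul1r. Qed.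
Lemma NfMod_scalerDr : right_distributive (fun c (u : NfMod) => cstN c * u : NfMod) +%R.
Proof. by move=> c u v; apply: mulrDr. Qed.
Lemma NfMod_scalerDl (u : NfMod) :
  {morph (fun c => cstN c * u : NfMod) : c d / c + d}.
Proof. by move=> c d; rewrite rmorphD /= mulrDl. Qed.
HB.instance Definition _ := GRing.Zmodule_isLmodule.Build C NfMod
  NfMod_scalerA NfMod_scale1r NfMod_scalerDr NfMod_scalerDl.

Lemma separating_functional_V1 (w : N) : ~ V1 w ->
  exists phi : N -> C, [/\ functional phi, forall u, V1 u -> phi u = 0 & phi w = 1].
Proof.
have sV1 : subspace (V1 (f := f) : NfMod -> Prop).
  split=> [|c u v hu hv]; first exact: V1_0.
  by apply: V1_D => //; apply: V1_fun.
move=> /(separating_functional sV1)[phi [phi0 phi1]].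
exists phi; split=> //; split=> [u v|c u].
  exact: (linearD phi).
by have := linearP phi c (u : NfMod) 0; rewrite !addr0 linear0 addr0.
Qed.

Lemma Frac_additive n (p q : {mpoly A[r]}) :
  Frac (prodf f) (p + q) n = Frac (prodf f) p n + Frac (prodf f) q n.
Proof. by rewrite !FracN rmorphD mulrDl. Qed.

Lemma Frac_monomial_ind (P : N -> Prop) :
  P 0 -> (forall u v, P u -> P v -> P (u + v)) ->
  (forall a m n, P (Frac (prodf f) (a *: 'X_[m]) n)) -> forall u, P u.
Proof.
move=> P0 PD Pm; apply: FracP => p n; rewrite FracN [p]mpolyE rmorph_sum mulr_suml.
by apply: (big_ind P P0 PD) => m _; rewrite -FracN.
Qed.

Lemma Frac_expand (p : {mpoly A[r]}) n l :
  Frac (prodf f) p n = Frac (prodf f) (prodf f ^+ l * p) (n + l).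
Proof. by apply/FracE; exists 0%N; rewrite expr0 !mul1r mulrA exprD. Qed.

End Functionals.

Section CoefficientwiseSum.
Variables (S : comNzRingType) (n : nat) (V : zmodType).
Variable lam : 'X_{1..n} -> S -> V.
Hypothesis lamD : forall m a b, lam m (a + b) = lam m a + lam m b.

(** An additive map on polynomials whose effect on a coefficient depends on the
    monomial. *)
Definition coeff_sum (p : {mpoly S[n]}) : V := \sum_(m <- msupp p) lam m p@_m.

Lemma coeff_map0 m : lam m 0 = 0.
Proof. by apply: (addIr (lam m 0)); rewrite -lamD !add0r. Qed.

Lemma coeff_sumE k p : (msize p <= k)%N ->
  coeff_sum p = \sum_(m : 'X_{1..n < k}) lam m p@_m.
Proof.
move=> le_pk; rewrite /coeff_sum (big_mksub 'X_{1..n < k}) ?msupp_uniq //=; first last.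
  by move=> x /msize_mdeg_lt /leq_trans; apply.
rewrite big_rmcond //= => j /memN_msupp_eq0 ->.
exact: coeff_map0.
Qed.

Lemma coeff_sumD p q : coeff_sum (p + q) = coeff_sum p + coeff_sum q.
Proof.
pose k := maxn (msize (p + q)) (maxn (msize p) (msize q)).
rewrite !(@coeff_sumE k) ?leq_max ?leqnn ?orbT // -big_split.
by apply: eq_bigr => m _; rewrite mcoeffD lamD.
Qed.

Lemma coeff_sum_monomial a m : coeff_sum (a *: 'X_[m]) = lam m a.
Proof.
have [->|a0] := eqVneq a 0; first by rewrite scale0r /coeff_sum msupp0 big_nil coeff_map0.
by rewrite /coeff_sum msuppMCX // big_seq1 mcoeffZ mcoeffX eqxx mulr1.
Qed.

End CoefficientwiseSum.

(** * The tensor product of two functionals *)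

Section ProductFunctional.
Variables (C : fieldType) (A B T : comAlgType C).
Variables (i1 : {lrmorphism A -> T}) (i2 : {lrmorphism B -> T}).
Hypothesis prodT : product_ring i1 i2.
Variables (r r' : nat) (f : 'I_r -> A) (g : 'I_r' -> B).
Local Notation h := (product_map i1 i2 f g).
Variables (iota1 : {rmorphism Nf f -> Nf h}) (iota2 : {rmorphism Nf g -> Nf h}).
Hypothesis iota1P : is_pullback i1 (lshift r') iota1.
Hypothesis iota2P : is_pullback i2 (@rshift r r') iota2.
Variables (phi : Nf f -> C) (psi : Nf g -> C).
Hypotheses (phiP : functional phi) (psiP : functional psi).

Definition mnm_l (m : 'X_{1..r + r'}) : 'X_{1..r} := [multinom m (lshift r' i) | i < r].
Definition mnm_r (m : 'X_{1..r + r'}) : 'X_{1..r'} := [multinom m (rshift r j) | j < r'].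
Definition mnm_cat (m : 'X_{1..r}) (m' : 'X_{1..r'}) : 'X_{1..r + r'} :=
  [multinom (match split k with inl i => m i | inr j => m' j end) | k < r + r'].

Lemma mnm_catl m m' : mnm_l (mnm_cat m m') = m.
Proof. by apply/mnmP => i; rewrite !mnmE (unsplitK (inl i)). Qed.

Lemma mnm_catr m m' : mnm_r (mnm_cat m m') = m'.
Proof. by apply/mnmP => i; rewrite !mnmE (unsplitK (inr i)). Qed.

Lemma functional_monomial r0 (A0 : comAlgType C) (f0 : 'I_r0 -> A0)
    (phi0 : Nf f0 -> C) m n c a b : functional phi0 ->
  phi0 (Frac (prodf f0) ((c *: a + b) *: 'X_[m]) n) =
  c * phi0 (Frac (prodf f0) (a *: 'X_[m]) n) + phi0 (Frac (prodf f0) (b *: 'X_[m]) n).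
Proof.
case=> phiD phiZ; rewrite scalerDl Frac_additive phiD -phiZ !FracN mulrA.
congr (phi0 (_ * _) + _).
by rewrite /cstN /funN -rmorphM mul_mpolyC scalerA mulr_algl.
Qed.

(** The functional phi (x) psi on the fractions with denominator of exponent n
    and a fixed monomial in the s_i: the universal property of T gives it as a
    function of the coefficient. *)
Lemma coeff_functional (x : nat * 'X_{1..r + r'}) : exists lam : {linear T -> C^o},
  forall a b, lam (i1 a * i2 b) =
    phi (Frac (prodf f) (a *: 'X_[mnm_l x.2]) x.1) *
    psi (Frac (prodf g) (b *: 'X_[mnm_r x.2]) x.1).
Proof.
have [|lam lamE _] := prodT (V := C^o) (m := fun a b =>
    phi (Frac (prodf f) (a *: 'X_[mnm_l x.2]) x.1) *
    psi (Frac (prodf g) (b *: 'X_[mnm_r x.2]) x.1)); last by exists lam.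
split=> [c a a' b|c a b b'] /=; rewrite functional_monomial //.
  by rewrite mulrDl -mulrA.
by rewrite mulrDr mulrCA.
Qed.

Lemma Frac_product a b m m' n :
  iota1 (Frac (prodf f) (a *: 'X_[m]) n) * iota2 (Frac (prodf g) (b *: 'X_[m']) n) =
  Frac (prodf h) ((i1 a * i2 b) *: 'X_[mnm_cat m m']) n.
Proof.
rewrite !FracN !rmorphM !rmorphXn !rmorph_prod /=.
under eq_bigr do rewrite (pullback_finv (product_map_l i1 i2 f g) iota1P).
under [X in _ * (_ * X ^+ _)]eq_bigr do
  rewrite (pullback_finv (product_map_r i1 i2 f g) iota2P).
rewrite [in RHS]big_split_ord /= exprMn mulrACA; congr (_ * _).
rewrite -!mul_mpolyC !rmorphM /= -!/(funN _ _) !(proj1 iota1P) !(proj1 iota2P).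
rewrite mulrACA -rmorphM; congr (_ * _).
rewrite !mpolyXE_id !rmorph_prod [RHS]big_split_ord /=.
congr (_ * _); apply: eq_bigr => i _.
  by rewrite !rmorphXn /= -!/(sN _ _) (proj2 iota1P) mnmE (unsplitK (inl i)).
by rewrite !rmorphXn /= -!/(sN _ _) (proj2 iota2P) mnmE (unsplitK (inr i)).
Qed.

(** [Nf h] is the tensor product of [Nf f] and [Nf g]; the functional phi (x) psi is
    defined on numerators for each exponent n of the denominator, and these
    definitions agree when n grows because they do on monomials. *)
Lemma product_functional : exists Phi : Nf h -> C,
  (forall w w', Phi (w + w') = Phi w + Phi w') /\
  forall u v, Phi (iota1 u * iota2 v) = phi u * psi v.
Proof.
have [lam lamE] := choice coeff_functional.
pose L n (p : {mpoly T[r + r']}) : C := coeff_sum (fun m t => lam (n, m) t) p.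
have lamD n m a b : lam (n, m) (a + b) = lam (n, m) a + lam (n, m) b by rewrite linearD.
have LD n p q : L n (p + q) = L n p + L n q.
  by apply: coeff_sumD => m a b; apply: lamD.
have lamS n m t : lam (n, m) t = lam (n.+1, m) (\prod_k h k * t).
  rewrite big_split_ord /=.
  under eq_bigr do rewrite product_map_l.
  under [X in _ * X * _]eq_bigr do rewrite product_map_r.
  rewrite -!rmorph_prod; move: t; apply: (tensor_ind prodT) => [|x y hx hy|a b].
  - by rewrite mulr0 !linear0.
  - by rewrite mulrDr !linearD hx hy.
  rewrite mulrACA -!rmorphM !lamE /= -addn1.
  rewrite [Frac _ (a *: _) n](Frac_expand f _ n 1) [Frac _ (b *: _) n](Frac_expand g _ n 1).
  by rewrite !expr1 /prodf !mul_mpolyC !scalerA.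
have LS n p : L n p = L n.+1 (prodf h * p).
  pose k := maxn (msize p) (msize (prodf h * p)).
  rewrite /L !(@coeff_sumE _ _ _ _ _ k) ?leq_max ?leqnn ?orbT //.
  by apply: eq_bigr => m _; rewrite mcoeffCM -lamS.
have Ladd n j p : L n p = L (n + j)%N (prodf h ^+ j * p).
  elim: j => [|j IH]; first by rewrite addn0 mul1r.
  by rewrite IH LS addnS mulrA -exprS.
pose Phi (w : Nf h) : C := loc_lift (fun p n => L n p) w.
have PhiE p n : Phi (Frac (prodf h) p n) = L n p.
  apply: loc_liftE => q m k e.
  have mkn : (m + (k + n) = n + (k + m))%N by rewrite addnCA [RHS]addnCA [(n + m)%N]addnC.
  by rewrite (Ladd n (k + m)%N) (Ladd m (k + n)%N) mkn !exprD -!mulrA e.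
have PhiD w w' : Phi (w + w') = Phi w + Phi w'.
  move: w w'; apply: FracP => p m; apply: FracP => q n.
  by rewrite FracD !PhiE LD [(m + n)%N]addnC -Ladd [(n + m)%N]addnC -Ladd.
have Phi0 : Phi 0 = 0 by apply: (addIr (Phi 0)); rewrite -PhiD !add0r.
exists Phi; split=> // u v; have [phiD _] := phiP; have [psiD _] := psiP.
move: u; apply: Frac_monomial_ind => [|u u' hu hu'|a m n].
- by rewrite rmorph0 mul0r (functional0 phiP) mul0r.
- by rewrite rmorphD mulrDl PhiD hu hu' phiD mulrDl.
move: v; apply: Frac_monomial_ind => [|v v' hv hv'|b m' n'].
- by rewrite rmorph0 mulr0 (functional0 psiP) mulr0.
- by rewrite rmorphD mulrDr PhiD hv hv' psiD mulrDr.
rewrite (Frac_expand f _ n n') (Frac_expand g _ n' n) [(n' + n)%N]addnC.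
rewrite /prodf -!rmorphXn /= !mul_mpolyC !scalerA Frac_product PhiE.
by rewrite /L coeff_sum_monomial // lamE /= mnm_catl mnm_catr.
Qed.

End ProductFunctional.

(** * Polynomials in s *)

Section PolynomialsInS.
Variables (C : fieldType) (A : comAlgType C) (r : nat) (f : 'I_r -> A).
Local Notation N := (Nf f).

Definition polyN (b : {poly C}) : N := inN f (eval_s A r b).

Lemma eval_s_zmod_morphism : zmod_morphism (eval_s A r).
Proof.
pose c : {rmorphism C -> {mpoly A[r]}} := @mpolyC r A \o in_alg A.
move=> p q; rewrite /eval_s (_ : (fun _ => _) = c) //.
by rewrite rmorphB hornerD hornerN.
Qed.

Lemma eval_s_monoid_morphism : monoid_morphism (eval_s A r).
Proof.
pose c : {rmorphism C -> {mpoly A[r]}} := @mpolyC r A \o in_alg A.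
rewrite /eval_s; split=> [|p q]; rewrite (_ : (fun _ => _) = c) //.
  by rewrite rmorph1 hornerC.
by rewrite rmorphM hornerM.
Qed.

HB.instance Definition _ := GRing.isZmodMorphism.Build {poly C} {mpoly A[r]}
  (eval_s A r) eval_s_zmod_morphism.
HB.instance Definition _ := GRing.isMonoidMorphism.Build {poly C} {mpoly A[r]}
  (eval_s A r) eval_s_monoid_morphism.

Lemma polyN_zmod_morphism : zmod_morphism polyN.
Proof. by move=> p q; rewrite /polyN !rmorphB. Qed.

Lemma polyN_monoid_morphism : monoid_morphism polyN.
Proof. by split=> [|p q]; rewrite /polyN ?rmorph1 ?rmorphM. Qed.

HB.instance Definition _ := GRing.isZmodMorphism.Build {poly C} N
  polyN polyN_zmod_morphism.
HB.instance Definition _ := GRing.isMonoidMorphism.Build {poly C} N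
  polyN polyN_monoid_morphism.

Lemma polyNX : polyN 'X = \sum_i sN f i.
Proof.
pose c : {rmorphism C -> {mpoly A[r]}} := @mpolyC r A \o in_alg A.
rewrite /polyN /eval_s (_ : (fun _ => _) = c) // map_polyX hornerX.
exact: rmorph_sum.
Qed.

Lemma polyNC c : polyN c%:P = cstN f c.
Proof.
pose phi : {rmorphism C -> {mpoly A[r]}} := @mpolyC r A \o in_alg A.
by rewrite /polyN /eval_s (_ : (fun _ => _) = phi) // map_polyC hornerC.
Qed.

Lemma polyNZ c p : polyN (c *: p) = cstN f c * polyN p.
Proof. by rewrite -mul_polyC rmorphM /= polyNC. Qed.

Lemma V1_s_mul i (u : N) : V1 u -> V1 (sN f i * u).
Proof. by move=> hu; rewrite -[u](t_opK i); apply: (V1_s i i). Qed.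

Lemma V1_polyN_mul p (u : N) : V1 u -> V1 (polyN p * u).
Proof.
move: u; apply: (inN_ind (P := fun x => forall u, V1 u -> V1 (x * u)))
  => [x y hx hy|x y hx hy|a|i] u hu.
- by rewrite mulrDl; apply: V1_D; [apply: hx|apply: hy].
- by rewrite -mulrA; apply: hx; apply: hy.
- exact: V1_fun.
- exact: V1_s_mul.
Qed.

(** The polynomials p such that p(s) f^s is in V^1 form an ideal, since V^1 is
    stable under s; its monic generator is b. *)
Lemma BernsteinSato_dvdp b p : is_BernsteinSato f b -> V1 (polyN p) <-> b %| p.
Proof.
case=> b_monic /functional_equationE Vb b_min; split=> [Vp|/dvdpP[q ->]]; last first.
  by rewrite rmorphM; apply: V1_polyN_mul.
have Vr : V1 (polyN (p %% b)).
  rewrite (_ : p %% b = p - p %/ b * b); last by rewrite {2}(divp_eq p b) addrAC subrr add0r.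
  rewrite rmorphB; apply: V1_D => //.
  by rewrite -mulN1r -(rmorphN1 polyN) rmorphM; do 2!apply: V1_polyN_mul.
rewrite /dvdp; apply: contraT => r_neq0.
have lc0 : lead_coef (p %% b) != 0 by rewrite lead_coef_eq0.
have := b_min ((lead_coef (p %% b))^-1 *: (p %% b)).
rewrite monicE lead_coefZ mulVf // eqxx size_scale ?invr_eq0 // leqNgt ltn_modp.
rewrite monic_neq0 //; apply=> //; apply/functional_equationE.
by rewrite -/(polyN _) -mul_polyC rmorphM; apply: V1_polyN_mul.
Qed.

End PolynomialsInS.

Section PullbackV1.
Variables (C : fieldType) (A T : comAlgType C) (rho : {lrmorphism A -> T}).
Variables (r n : nat) (f : 'I_r -> A) (h : 'I_n -> T) (sigma : 'I_r -> 'I_n).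
Variable iota : {rmorphism Nf f -> Nf h}.
Hypothesis iotaP : is_pullback rho sigma iota.

Lemma V1_pullback_mul p w : V1 w -> V1 (iota (polyN f p) * w).
Proof.
move: w; apply: (inN_ind (P := fun x => forall w, V1 w -> V1 (iota x * w)))
  => [x y hx hy|x y hx hy|a|i] w hw.
- by rewrite rmorphD mulrDl; apply: V1_D; [apply: hx|apply: hy].
- by rewrite rmorphM -mulrA; apply: hx; apply: hy.
- by rewrite (proj1 iotaP); apply: V1_fun.
- by rewrite (proj2 iotaP); apply: V1_s_mul.
Qed.

Lemma pullback_cst c : iota (cstN f c) = cstN h c.
Proof. by rewrite /cstN (proj1 iotaP) linearZ /= rmorph1. Qed.

End PullbackV1.

(** Nullstellensatz in one variable: an element of least degree divides the whole
    ideal, so that its roots would be common zeros. *)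
Lemma ideal_without_zeros (F : closedFieldType) (S : {poly F} -> Prop) :
  (forall p q, S p -> S q -> S (p + q)) -> (forall p q, S p -> S (q * p)) ->
  (forall z, exists2 p, S p & p.[z] != 0) -> S 1.
Proof.
move=> SD SM Sz.
pose Q n := `[< exists p, [/\ S p, p != 0 & size p = n] >].
have [p0 Sp0 p00] := Sz 0.
have exQ : exists n, Q n.
  exists (size p0); apply/asboolP; exists p0; split=> //.
  by apply: contraNneq p00 => ->; rewrite horner0.
case: (ex_minnP exQ) => n /asboolP[d [Sd d0 dn]] n_min.
have dvd e : S e -> d %| e.
  move=> Se; rewrite /dvdp; apply: contraT => r0.
  have Sr : S (e %% d).
    rewrite (_ : e %% d = e + - (e %/ d) * d).
      by apply: SD => //; apply: SM.
    by rewrite {2}(divp_eq e d) mulNr addrAC subrr add0r.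
  have /n_min : Q (size (e %% d)) by apply/asboolP; exists (e %% d).
  by rewrite leqNgt -dn ltn_modp d0.
have [s1|/closed_rootP[z dz]] := eqVneq (size d) 1.
  have /size_poly1P[c c0 dc] : size d == 1 by rewrite s1.
  have -> : 1 = c^-1%:P * d by rewrite dc -polyCM mulVf.
  exact: SM.
have [e /dvd/dvdpP[q ->]] := Sz z.
by rewrite hornerM (rootP dz) mulr0 eqxx.
Qed.

Section Multiplicities.
Variable F : fieldType.
Implicit Types (b : {poly F}) (a : F).

Definition Xadd a : {poly F} := 'X - (- a)%:P.

Lemma mult_geq b a n : b != 0 -> (n <= mult b a)%N = (Xadd a ^+ n %| b).
Proof. exact: mup_geq. Qed.

Lemma mult_split b a : b != 0 ->
  exists2 e, b = Xadd a ^+ mult b a * e & e.[- a] != 0.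
Proof.
move=> b0; have : Xadd a ^+ mult b a %| b by rewrite -mult_geq.
case/dvdpP=> e be; exists e; first by rewrite mulrC.
apply/negP => /eqP/rootP; rewrite root_factor_theorem => /dvdpP[e' ee'].
have : Xadd a ^+ (mult b a).+1 %| b.
  by rewrite {2}be ee' exprS -mulrA dvdp_mull // /Xadd.
by rewrite -mult_geq // ltnn.
Qed.

Lemma mult_lt_size b a : b != 0 -> (mult b a < size b)%N.
Proof.
move=> b0; have : Xadd a ^+ mult b a %| b by rewrite -mult_geq.
move/dvdp_leq => /(_ b0); rewrite size_exp_XsubC //.
Qed.

Lemma mult0_nonroot b a : b != 0 -> mult b a = 0%N -> b.[- a] != 0.
Proof.
by move=> b0 /eqP; rewrite -leqn0 /mult mup_leq // expr1 dvdp_XsubCl.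
Qed.

Lemma dvdp_mult_cofactor b e a l : b != 0 -> b = Xadd a ^+ mult b a * e ->
  (b %| Xadd a ^+ l * e) = (mult b a <= l)%N.
Proof.
move=> b0 be; have e0 : e != 0 by apply: contraNneq b0 => e0; rewrite be e0 mulr0.
rewrite [X in X %| _]be dvdp_mul2r //.
apply/idP/idP => [/dvdp_leq|]; last exact: dvdp_exp2l.
by rewrite expf_neq0 ?polyXsubC_eq0 // !size_exp_XsubC ltnS; apply.
Qed.

End Multiplicities.

(** * The Bernstein-Sato polynomial of a product *)

Section ProductBernsteinSato.
Variables (C : numClosedFieldType) (A B T : comAlgType C).
Variables (i1 : {lrmorphism A -> T}) (i2 : {lrmorphism B -> T}).
Hypothesis prodT : product_ring i1 i2.
Hypotheses (ftA : finite_type A) (ftB : finite_type B).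
Variables (r r' : nat) (f : 'I_r -> A) (g : 'I_r' -> B).
Local Notation h := (product_map i1 i2 f g).
Variables (iota1 : {rmorphism Nf f -> Nf h}) (iota2 : {rmorphism Nf g -> Nf h}).
Hypothesis iota1P : is_pullback i1 (lshift r') iota1.
Hypothesis iota2P : is_pullback i2 (@rshift r r') iota2.
Variables bf bg bh : {poly C}.
Hypotheses (hbf : is_BernsteinSato f bf) (hbg : is_BernsteinSato g bg).
Hypothesis hbh : is_BernsteinSato h bh.

Lemma BernsteinSato_neq0 r0 (A0 : comAlgType C) (f0 : 'I_r0 -> A0) b :
  is_BernsteinSato f0 b -> b != 0.
Proof. by case=> /monic_neq0. Qed.

Lemma polyN_Xadd a b :
  polyN h (Xadd (a + b)) = iota1 (polyN f (Xadd a)) + iota2 (polyN g (Xadd b)).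
Proof.
rewrite /Xadd !rmorphB /= !polyNX !polyNC big_split_ord /= !rmorph_sum /=.
rewrite (pullback_cst iota1P) (pullback_cst iota2P) opprD rmorphD /= opprD addrACA.
by congr (_ + _ + (_ + _)); apply: eq_bigr => i _;
  rewrite ?(proj2 iota1P) ?(proj2 iota2P).
Qed.

(** (x+a + y+b)^l p(x) q(y), evaluated at x = s_f and y = s_g. *)
Lemma polyN_Xadd_expand a b l p q :
  polyN h (Xadd (a + b) ^+ l) * (iota1 (polyN f p) * iota2 (polyN g q)) =
  \sum_(t < l.+1) (iota1 (polyN f (Xadd a ^+ (l - t) * p)) *
                   iota2 (polyN g (Xadd b ^+ t * q))) *+ 'C(l, t).
Proof.
rewrite rmorphXn /= polyN_Xadd exprDn mulr_suml; apply: eq_bigr => t _.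
by rewrite mulrnAl mulrACA !rmorphM !rmorphXn.
Qed.

(** With ea = b_f / (x+a)^n and eb = b_g / (y+b)^m, every term of the expansion of
    (x+a + y+b)^(n+m-1) ea(x) eb(y) is divisible by b_f(x) or b_g(y); so c(s) ea eb
    is in V^1 for all roots a and b.  The cofactors ea, together with b_f, have no
    common zero, and likewise for eb and b_g, so that ea and then eb can be
    replaced with 1. *)
Lemma upper_bound (c : {poly C}) : c != 0 ->
  (forall a b, (0 < mult bf a)%N -> (0 < mult bg b)%N ->
     (mult bf a + mult bg b - 1 <= mult c (a + b))%N) ->
  V1 (polyN h c).
Proof.
move=> c0 cP; have bf0 := BernsteinSato_neq0 hbf; have bg0 := BernsteinSato_neq0 hbg.
have V1f p w : bf %| p -> V1 (iota1 (polyN f p) * iota2 (polyN g w)).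
  move/(BernsteinSato_dvdp p hbf)/(V1_iota1 iota1P iota2P prodT) => hp.
  by rewrite mulrC; apply: (V1_pullback_mul iota2P).
have V1g p w : bg %| p -> V1 (iota1 (polyN f w) * iota2 (polyN g p)).
  move/(BernsteinSato_dvdp p hbg)/(V1_iota2 iota1P iota2P prodT) => hp.
  exact: (V1_pullback_mul iota1P).
have V1Mn (w : Nf h) k : V1 w -> V1 (w *+ k).
  by move=> hw; elim: k => [|k IH]; [apply: V1_0|rewrite mulrS; apply: V1_D].
have local a b ea eb : bf = Xadd a ^+ mult bf a * ea -> bg = Xadd b ^+ mult bg b * eb ->
    (0 < mult bf a)%N -> (0 < mult bg b)%N ->
    V1 (polyN h c * (iota1 (polyN f ea) * iota2 (polyN g eb))).
  move=> bfa bgb a0 b0; have := cP a b a0 b0; rewrite mult_geq // => /dvdpP[d ->].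
  rewrite rmorphM -mulrA; apply: V1_polyN_mul; rewrite polyN_Xadd_expand.
  apply: (big_ind (@V1 _ _ _ h) (V1_0 h) (@V1_D _ _ _ h)) => t _; apply: V1Mn.
  have [nt|nt] := leqP (mult bf a) (mult bf a + mult bg b - 1 - t).
    by apply: V1f; rewrite {1}bfa dvdp_mul // dvdp_exp2l.
  apply: V1g; rewrite {1}bgb dvdp_mul // dvdp_exp2l //.
  by move: nt a0; clear; lia.
have stepf b eb : bg = Xadd b ^+ mult bg b * eb -> (0 < mult bg b)%N ->
    V1 (polyN h c * iota2 (polyN g eb)).
  move=> bgb b0.
  suff : V1 (polyN h c * (iota1 (polyN f 1) * iota2 (polyN g eb))).
    by rewrite !rmorph1 mul1r.
  apply: (@ideal_without_zeros _ (fun p =>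
    V1 (polyN h c * (iota1 (polyN f p) * iota2 (polyN g eb))))) => [p q hp hq|p q hp|z].
  - by rewrite !rmorphD /= mulrDl mulrDr; apply: V1_D.
  - rewrite !rmorphM /= -mulrA mulrCA; exact: (V1_pullback_mul iota1P).
  have [z0|z0] := posnP (mult bf (- z)).
    exists bf; last by have := mult0_nonroot bf0 z0; rewrite opprK.
    by apply: V1_polyN_mul; apply: V1f.
  have [e bfe ez] := mult_split (- z) bf0.
  by exists e; [apply: (local (- z) b)|rewrite opprK in ez].
suff : V1 (polyN h c * iota2 (polyN g 1)) by rewrite !rmorph1 mulr1.
apply: (@ideal_without_zeros _ (fun p =>
  V1 (polyN h c * iota2 (polyN g p)))) => [p q hp hq|p q hp|z].
- by rewrite !rmorphD /= mulrDr; apply: V1_D.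
- rewrite !rmorphM /= mulrCA; exact: (V1_pullback_mul iota2P).
have [z0|z0] := posnP (mult bg (- z)).
  exists bg; last by have := mult0_nonroot bg0 z0; rewrite opprK.
  by apply: V1_polyN_mul; rewrite -[iota2 _]mul1r -(rmorph1 iota1) -(rmorph1 (polyN f)); apply: V1g.
have [e bge ez] := mult_split (- z) bg0.
by exists e; [apply: (stepf (- z))|rewrite opprK in ez].
Qed.

(** An element of V^j_f (x) V^(1-j)_g has its first factor in V^1_f if j >= 1, and
    its second one in V^1_g otherwise. *)
Lemma product_functional_V1 (phi : Nf f -> C) (psi : Nf g -> C) :
  functional phi -> functional psi ->
  (forall u, V1 u -> phi u = 0) -> (forall v, V1 v -> psi v = 0) ->
  exists Phi : Nf h -> C,
    [/\ forall w w', Phi (w + w') = Phi w + Phi w',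
        forall u v, Phi (iota1 u * iota2 v) = phi u * psi v &
        forall w, V1 w -> Phi w = 0].
Proof.
move=> phiP psiP phi0 psi0.
have [Phi [PhiD PhiE]] := product_functional prodT iota1P iota2P phiP psiP.
exists Phi; split=> // w.
move/(V1_V1prod iota1P iota2P prodT ftA ftB); elim=> {w} [l u v|l u v||w w' _ hw _ hw'].
- by move=> /Vup_V1 hu _; rewrite PhiE phi0 ?mul0r.
- by move=> _ /Vup_V1 hv; rewrite PhiE psi0 ?mulr0.
- by apply: (addIr (Phi 0)); rewrite -PhiD !add0r.
- by rewrite PhiD hw hw' addr0.
Qed.

(** With ea and eb the cofactors of (x+a)^n and (y+b)^m in b_f and b_g, choose phi
    and psi with value 1 on (x+a)^(n-1) ea and (y+b)^(m-1) eb.  If the order k of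
    b_h at a + b were at most n + m - 2, one could choose i and j with
    (n-1-i) + (m-1-j) = k; then phi (x) psi would send b_h(s) (x+a)^i ea (y+b)^j eb,
    which is in V^1, to a binomial coefficient times the lowest Taylor coefficient
    of b_h at - (a + b). *)
Lemma lower_bound a b : (0 < mult bf a)%N -> (0 < mult bg b)%N ->
  (mult bf a + mult bg b - 1 <= mult bh (a + b))%N.
Proof.
have bf0 := BernsteinSato_neq0 hbf; have bg0 := BernsteinSato_neq0 hbg.
have bh0 := BernsteinSato_neq0 hbh.
have [ea bfa ea0] := mult_split a bf0; have [eb bgb eb0] := mult_split b bg0.
have [eh bhe eh0] := mult_split (a + b) bh0.
set n := mult bf a in bfa *; set m := mult bg b in bgb *; set k := mult bh _ in bhe *.
move=> n0 m0; rewrite leqNgt; apply/negP => k_lt.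
have [|phi [phiP phi0 phi1]] :=
    @separating_functional_V1 _ _ _ f (polyN f (Xadd a ^+ n.-1 * ea)).
  by move/(BernsteinSato_dvdp _ hbf); rewrite dvdp_mult_cofactor // -/n; move: n0; clear; lia.
have [|psi [psiP psi0 psi1]] :=
    @separating_functional_V1 _ _ _ g (polyN g (Xadd b ^+ m.-1 * eb)).
  by move/(BernsteinSato_dvdp _ hbg); rewrite dvdp_mult_cofactor // -/m; move: m0; clear; lia.
have phi_top l : (n <= l)%N -> phi (polyN f (Xadd a ^+ l * ea)) = 0.
  by move=> nl; apply/phi0/(BernsteinSato_dvdp _ hbf); rewrite dvdp_mult_cofactor.
have psi_top l : (m <= l)%N -> psi (polyN g (Xadd b ^+ l * eb)) = 0.
  by move=> nl; apply/psi0/(BernsteinSato_dvdp _ hbg); rewrite dvdp_mult_cofactor.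
have [Phi [PhiD PhiE PhiV1]] := product_functional_V1 phiP psiP phi0 psi0.
have Phi0 : Phi 0 = 0 by apply: (addIr (Phi 0)); rewrite -PhiD !add0r.
have PhiMn w l : Phi (w *+ l) = Phi w *+ l.
  by elim: l => [|l IH]; rewrite ?mulr0n ?mulrS ?PhiD ?IH.
(* The exponents p0 of x+a and q0 of y+b by which the vector w falls short of the top. *)
have [p0 [q0 [pn qm pq]]] : exists p q, [/\ (p < n)%N, (q < m)%N & (p + q = k)%N].
  exists (minn k n.-1), (k - minn k n.-1)%N.
  by move: n0 m0 k_lt; clear; split; lia.
pose i := (n.-1 - p0)%N; pose j := (m.-1 - q0)%N.
pose w := iota1 (polyN f (Xadd a ^+ i * ea)) * iota2 (polyN g (Xadd b ^+ j * eb)).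
have term c l : Phi (polyN h (c *: Xadd (a + b) ^+ l) * w) =
    c * \sum_(t < l.+1) (phi (polyN f (Xadd a ^+ (l - t + i) * ea)) *
                     psi (polyN g (Xadd b ^+ (t + j) * eb))) *+ 'C(l, t).
  have -> : polyN h (c *: Xadd (a + b) ^+ l) * w = polyN h (Xadd (a + b) ^+ l) *
      (iota1 (polyN f (c *: (Xadd a ^+ i * ea))) * iota2 (polyN g (Xadd b ^+ j * eb))).
    by rewrite !polyNZ rmorphM /= (pullback_cst iota1P) mulrAC mulrC -!mulrA.
  rewrite polyN_Xadd_expand (big_morph Phi PhiD Phi0) mulr_sumr; apply: eq_bigr => t _.
  rewrite PhiMn PhiE !mulrA -exprD -scalerAr polyNZ (proj2 phiP) mulrA -exprD.
  by rewrite [in RHS]mulrnAr [in RHS]mulrA.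
have term_gt c l : (k < l)%N -> Phi (polyN h (c *: Xadd (a + b) ^+ l) * w) = 0.
  move=> kl; rewrite term big1 ?mulr0 // => t _.
  have [nt|nt] := leqP n (l - t + i); first by rewrite phi_top // mul0r mul0rn.
  rewrite psi_top ?mulr0 ?mul0rn //.
  by move: nt kl pq pn qm (ltn_ord t); rewrite /i /j; clear; lia.
have term_k c : Phi (polyN h (c *: Xadd (a + b) ^+ k) * w) = c * 'C(k, q0)%:R.
  have q0k : (q0 < k.+1)%N by rewrite -pq; clear; lia.
  rewrite term (bigD1 (Ordinal q0k)) //= big1 => [|t tq]; last first.
    have [nt|nt] := leqP n (k - t + i); first by rewrite phi_top // mul0r mul0rn.
    rewrite psi_top ?mulr0 ?mul0rn //; move: tq; rewrite -val_eqE /=.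
    by move: nt pq pn qm (ltn_ord t); rewrite /i /j; clear; lia.
  rewrite (_ : k - q0 + i = n.-1)%N; last by move: pq pn; rewrite /i; clear; lia.
  rewrite (_ : q0 + j = m.-1)%N; last by move: pq qm; rewrite /j; clear; lia.
  by rewrite phi1 psi1 mulr1 addr0.
(* The Taylor expansion of bh at - (a + b), which starts in degree k. *)
pose e' := eh \Po ('X - (a + b)%:P).
have bh_exp : bh = \sum_(l < size e') e'`_l *: Xadd (a + b) ^+ (k + l).
  rewrite [LHS]bhe; under eq_bigr do rewrite exprD scalerAr.
  rewrite -mulr_sumr -comp_polyE /e' -comp_polyA comp_polyD comp_polyX.
  by rewrite /Xadd polyCN opprK rmorphN /= comp_polyC addrK comp_polyXr.
have e'0 : e'`_0 != 0 by rewrite -horner_coef0 /e' horner_comp hornerXsubC sub0r.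
have V1w : V1 (polyN h bh * w).
  rewrite mulrC /w -mulrA; apply: (V1_pullback_mul iota1P).
  by apply: (V1_pullback_mul iota2P); apply/(BernsteinSato_dvdp _ hbh).
move: (PhiV1 _ V1w); rewrite bh_exp rmorph_sum mulr_suml (big_morph Phi PhiD Phi0).
have se : (0 < size e')%N by rewrite size_poly_gt0; apply: contraNneq e'0 => ->; rewrite coef0.
rewrite (bigD1 (Ordinal se)) //= addn0 term_k big1 => [|l l0]; last first.
  by apply: term_gt; move: l0; rewrite -val_eqE /=; clear; lia.
apply/eqP; rewrite addr0 mulf_neq0 // Num.Theory.pnatr_eq0 -lt0n bin_gt0.
by rewrite -pq; clear; lia.
Qed.

(** For the upper estimate at gamma, [upper_bound] is applied to a polynomial whose
    order at gamma is the claimed one and whose order at every other sum of roots is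
    large. *)
Lemma product_BernsteinSato gamma :
  is_max0
    (fun k : nat => exists alpha beta : C,
       [/\ (0 < mult bf alpha)%N, (0 < mult bg beta)%N, alpha + beta = gamma &
           k = (mult bf alpha + mult bg beta - 1)%N])
    (mult bh gamma).
Proof.
set E := (fun k => _).
have bf0 := BernsteinSato_neq0 hbf; have bg0 := BernsteinSato_neq0 hbg.
have bh0 := BernsteinSato_neq0 hbh.
have E_le k : E k -> (k <= mult bh gamma)%N.
  by case=> a [b [a0 b0 <- ->]]; apply: lower_bound.
have le_E m0 : (forall k, E k -> (k <= m0)%N) -> (mult bh gamma <= m0)%N.
  move=> m0P; have [rf bfE] := closed_field_poly_normal bf.
  have [rg bgE] := closed_field_poly_normal bg.
  (* Any bound on the sum of two multiplicities. *)
  pose K := (size bf + size bg)%N.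
  (* The roots are - a and - b, so the pairs to be skipped have sum - gamma. *)
  pose d x y : {poly C} := if x + y == - gamma then 1 else ('X - (x + y)%:P) ^+ K.
  pose D := \prod_(x <- rf) \prod_(y <- rg) d x y.
  have root_in (p : {poly C}) rs x : p != 0 ->
      p = lead_coef p *: \prod_(z <- rs) ('X - z%:P) -> (0 < mult p x)%N -> - x \in rs.
    move=> p0 pE; rewrite mult_geq // expr1 dvdp_XsubCl {1}pE rootZ ?lead_coef_eq0 //.
    by rewrite root_prod_XsubC.
  have dg x y : (d x y).[- gamma] != 0.
    rewrite /d; case: (x + y =P - gamma) => [_|/eqP xy]; first by rewrite hornerC oner_eq0.
    by rewrite horner_exp hornerXsubC expf_neq0 // subr_eq0 eq_sym.
  have Dg : ~~ root D (- gamma).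
    have prod_neq0 (rs : seq C) (p : C -> {poly C}) :
        (forall x, (p x).[- gamma] != 0) -> (\prod_(x <- rs) p x).[- gamma] != 0.
      move=> p0; rewrite horner_prod; apply: (big_ind (fun x : C => x != 0)) => //.
        exact: oner_neq0.
      by move=> x y; apply: mulf_neq0.
    by apply: (prod_neq0) => x; apply: (prod_neq0) => y; apply: dg.
  have D0 : D != 0 by apply: contraNneq Dg => ->; apply: root0.
  pose c := Xadd gamma ^+ m0 * D.
  have Xg0 : Xadd gamma ^+ m0 != 0 by rewrite expf_neq0 ?polyXsubC_eq0.
  have c0 : c != 0 by rewrite mulf_neq0.
  have cg : mult c gamma = m0 by rewrite /mult mupMl // mup_XsubCX eqxx.
  rewrite -[X in (_ <= X)%N]cg mult_geq //.
  apply: (@dvdp_trans _ bh); first by rewrite -mult_geq.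
  apply/(BernsteinSato_dvdp _ hbh)/upper_bound => // a b a0 b0.
  have [ab|ab] := eqVneq (a + b) gamma.
    by rewrite ab cg; apply: m0P; exists a, b.
  rewrite mult_geq //; apply: dvdp_mull; apply: (@dvdp_trans _ (d (- a) (- b))).
    rewrite /d -opprD (inj_eq oppr_inj) (negbTE ab) dvdp_exp2l //.
    apply: leq_trans (leq_subr _ _) _.
    by apply: leq_add; apply/ltnW/mult_lt_size.
  rewrite /D (big_rem (- a)) /=; last exact: (root_in bf).
  rewrite dvdp_mulr // (big_rem (- b)) /=; last exact: (root_in bg).
  exact: dvdp_mulr.
have [[k0 Ek0]|E0] := pselect (exists k, E k); [left|right].
  split=> //; have exE : exists k, `[< E k >] by exists k0; apply/asboolP.
  have bE k : `[< E k >] -> (k <= mult bh gamma)%N by move/asboolP/E_le.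
  case: (ex_maxnP exE bE) => q /asboolP Eq q_max.
  suff -> : mult bh gamma = q by [].
  apply/eqP; rewrite eqn_leq E_le // andbT; apply: le_E => k /asboolP; exact: q_max.
split=> [k Ek|]; first by apply: E0; exists k.
apply/eqP; rewrite -leqn0; apply: le_E => k Ek; case: E0; by exists k.
Qed.

End ProductBernsteinSato.

Theorem theorem5 (R : realType)
    (A B T : comAlgType R[i])
    (i1 : {lrmorphism A -> T}) (i2 : {lrmorphism B -> T})
    (r r' : nat) (f : 'I_r -> A) (g : 'I_r' -> B)
    (bf bg bh : {poly R[i]})
    (smoothX : smooth_variety A) (smoothY : smooth_variety B)
    (prodXY : product_ring i1 i2)
    (f_neq0 : forall i, nonzero_on_components (f i))
    (g_neq0 : forall j, nonzero_on_components (g j))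
    (hbf : is_BernsteinSato f bf) (hbg : is_BernsteinSato g bg)
    (hbh : is_BernsteinSato (product_map i1 i2 f g) bh)
    (gamma : R[i]) :
  is_max0
    (fun k : nat => exists alpha beta : R[i],
       [/\ (0 < mult bf alpha)%N, (0 < mult bg beta)%N, alpha + beta = gamma &
           k = (mult bf alpha + mult bg beta - 1)%N])
    (mult bh gamma).
Proof.
have [iota1 iota1P] := pullback_exists (product_map_l i1 i2 f g).
have [iota2 iota2P] := pullback_exists (product_map_r i1 i2 f g).
have [ftA _] := smoothX; have [ftB _] := smoothY.
exact: (product_BernsteinSato prodXY ftA ftB iota1P iota2P hbf hbg hbh).
Qed.
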